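(* Let $(Q,R)$ be a gentle tree, and let $\mathcal N$ be the set of isomorphism classes of indecomposable non-projective objects of $\mathrm{rep}(Q,R)$, ordered by the Res-relation $\sqsubseteq$. For every resolving subcategory $\mathscr C\subseteq\mathrm{rep}(Q,R)$ there exists a unique antichain $\mathfrak E_{\mathscr C}$ of $(\mathcal N,\sqsubseteq)$ such that $$\mathscr C=\mathrm{add}\big(\mathrm{Res}(M)\mid M\in\mathfrak E_{\mathscr C}\big),$$ where, for the empty antichain, the right-hand side is understood to be the category of projective objects.
   Context: $\mathbb K$ is an algebraically closed field. A gentle tree is a (finite) gentle quiver $(Q,R)$ (with $R$ its set of length-two zero relations) whose underlying graph is a tree; $\mathrm{rep}(Q,R)$ is the category of finite-dimensional $\mathbb K$-representations of $(Q,R)$. A full subcategory of $\mathrm{rep}(Q,R)$ is resolving if it is closed under direct sums and direct summands, contains all projectives, and is closed under extensions and under kernels of epimorphisms. $\mathrm{Res}(\mathcal X)$ is the smallest resolving subcategory containing $\mathcal X$, and $\mathrm{Res}(M)=\mathrm{Res}(\{M\})$. For $X,Y\in\mathcal N$, $X\sqsubseteq Y$ means $\mathrm{Res}(X)\subseteq\mathrm{Res}(Y)$; this is a partial order on $\mathcal N$. $\mathrm{add}(\mathscr C_i)$ denotes the smallest full subcategory closed under direct sums and summands containing all the $\mathscr C_i$. *)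

(* Defs.v *)
From HB Require Import structures.
From mathcomp Require Import all_boot all_order all_algebra.

Set Implicit Arguments.
Unset Strict Implicit.
Unset Printing Implicit Defensive.

Import GRing.Theory.
Local Open Scope ring_scope.

(* A finite quiver Q with a set R of paths of length two; [arr x y] is the    *)
(* type of arrows from x to y, and [zrel a b] says that the path consisting   *)
(* of a followed by b belongs to R.                                           *)
Record bquiver := BQuiver {
  vert :> finType;
  arr : vert -> vert -> finType;
  zrel : forall x y z : vert, arr x y -> arr y z -> bool
}.

Section Quiver.
Variable Q : bquiver.

Definition arr_from (x : Q) : finType := {y : Q & arr x y}.
Definition arr_to (y : Q) : finType := {x : Q & arr x y}.

(* The usual further requirement that long paths contain a relation (so that  *)
(* the algebra is finite-dimensional) is automatic when Q is a finite tree,   *)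
(* which is the only case considered below.                                   *)
Definition gentle : Prop :=
  [/\ forall x : Q, (#|arr_from x| <= 2)%N,
      forall x : Q, (#|arr_to x| <= 2)%N,
      forall (x y : Q) (a : arr x y),
        (#|[set b : arr_from y | zrel a (tagged b)]| <= 1)%N
        /\ (#|[set b : arr_from y | ~~ zrel a (tagged b)]| <= 1)%N
    & forall (y z : Q) (b : arr y z),
        (#|[set a : arr_to y | zrel (tagged a) b]| <= 1)%N
        /\ (#|[set a : arr_to y | ~~ zrel (tagged a) b]| <= 1)%N].

(* The underlying graph is a multigraph: it may have loops and parallel       *)
(* edges, and these count as cycles.                                          *)
Definition edge : finType := {p : Q * Q & arr p.1 p.2}.

(* An edge together with a direction of travel: along the arrow for [true],   *)
(* against it for [false].                                                    *)
Definition step : finType := (edge * bool)%type.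
Definition step_source (u : step) : Q :=
  if u.2 then (tag u.1).1 else (tag u.1).2.
Definition step_target (u : step) : Q :=
  if u.2 then (tag u.1).2 else (tag u.1).1.

Definition graph_cycle (c : seq step) : bool :=
  [&& c != [::],
      path.cycle (fun u v => step_target u == step_source v) c,
      uniq [seq u.1 | u <- c]
    & uniq [seq step_source u | u <- c]].

Definition adjacent : rel Q :=
  fun x y => (0 < #|arr x y|)%N || (0 < #|arr y x|)%N.

Definition is_tree : Prop :=
  [/\ (0 < #|Q|)%N,
      forall x y : Q, connect adjacent x y
    & forall c : seq step, ~~ graph_cycle c].

Definition gentle_tree : Prop := gentle /\ is_tree.

End Quiver.

Section Representations.
Variables (K : fieldType) (Q : bquiver).

Record rep := Rep {
  rep_sp :> Q -> vectType K;
  rep_map : forall x y : Q, arr x y -> 'Hom(rep_sp x, rep_sp y);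
  rep_zrel : forall (x y z : Q) (a : arr x y) (b : arr y z),
    zrel a b -> (rep_map b \o rep_map a)%VF = 0
}.

Record rhom (M N : rep) := RHom {
  rhom_map :> forall x : Q, 'Hom(M x, N x);
  rhom_comm : forall (x y : Q) (a : arr x y),
    (rhom_map y \o rep_map M a)%VF = (rep_map N a \o rhom_map x)%VF
}.

Definition rep_iso (M N : rep) : Prop :=
  exists (f : rhom M N) (g : rhom N M),
    forall x : Q, (g x \o f x)%VF = \1%VF /\ (f x \o g x)%VF = \1%VF.

Definition epi (M N : rep) (f : rhom M N) : Prop :=
  forall x : Q, limg (f x) = fullv.

Definition short_exact (L M N : rep) (f : rhom L M) (g : rhom M N) : Prop :=
  forall x : Q, [/\ lker (f x) = 0%VS,
                    limg (f x) = lker (g x)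
                  & limg (g x) = fullv].

Definition zero_rep (M : rep) : Prop := forall x : Q, \dim {: M x} = 0%N.

Section DirectSum.
Variables M N : rep.

Definition dsum_map (x y : Q) (a : arr x y) :
    'Hom((M x * N x)%type, (M y * N y)%type) :=
  linfun (fun u : M x * N x => (rep_map M a u.1, rep_map N a u.2)).

Lemma dsum_mapE (x y : Q) (a : arr x y) (u : M x * N x) :
  dsum_map a u = (rep_map M a u.1, rep_map N a u.2).
Proof.
pose f (v : M x * N x) := (rep_map M a v.1, rep_map N a v.2).
have lf : linear f by move=> c v w; rewrite /f /= !linearP.
pose g := GRing.isLinear.Build K _ _ _ f lf.
pose h : {linear _ -> _} := HB.pack f g.
by rewrite /dsum_map (lfunE h).
Qed.

Lemma dsum_zrel (x y z : Q) (a : arr x y) (b : arr y z) :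
  zrel a b -> (dsum_map b \o dsum_map a)%VF = 0.
Proof.
move=> Rab; apply/lfunP => u; rewrite comp_lfunE !dsum_mapE /= zero_lfunE.
by rewrite -!comp_lfunE !(rep_zrel _ Rab) !zero_lfunE.
Qed.

Definition dsum : rep :=
  @Rep (fun x => (M x * N x)%type : vectType K) dsum_map dsum_zrel.

End DirectSum.

Definition projective (P : rep) : Prop :=
  forall (M N : rep) (g : rhom M N) (f : rhom P N), epi g ->
    exists h : rhom P M, forall x : Q, (g x \o h x)%VF = f x.

Definition indecomposable (M : rep) : Prop :=
  ~ zero_rep M /\
  forall X Y : rep, rep_iso M (dsum X Y) -> zero_rep X \/ zero_rep Y.

(* Full subcategories closed under isomorphism are identified with their     *)
(* classes of objects.  Likewise, a set of isomorphism classes is encoded as  *)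
(* an isomorphism-closed predicate on representations.                        *)
Definition rep_class := rep -> Prop.

Definition class_sub (C D : rep_class) : Prop := forall M : rep, C M -> D M.
Definition class_eq (C D : rep_class) : Prop := forall M : rep, C M <-> D M.

Definition iso_closed (C : rep_class) : Prop :=
  forall M N : rep, rep_iso M N -> C M -> C N.

Definition sum_summand_closed (C : rep_class) : Prop :=
  [/\ iso_closed C,
      forall M : rep, zero_rep M -> C M,
      forall M N : rep, C M -> C N -> C (dsum M N)
    & forall M N : rep, C (dsum M N) -> C M /\ C N].

Definition resolving (C : rep_class) : Prop :=
  [/\ sum_summand_closed C,
      forall P : rep, projective P -> C P,
      forall (L M N : rep) (f : rhom L M) (g : rhom M N),
        short_exact f g -> C L -> C N -> C M
    & forall (L M N : rep) (f : rhom L M) (g : rhom M N),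
        short_exact f g -> C M -> C N -> C L].

Definition add_closure (X : rep_class) : rep_class := fun M =>
  forall D : rep_class, sum_summand_closed D -> class_sub X D -> D M.

Definition Res (X : rep_class) : rep_class := fun M =>
  forall D : rep_class, resolving D -> class_sub X D -> D M.

Definition Res1 (M : rep) : rep_class := Res (fun N => N = M).

Definition res_le (M N : rep) : Prop := class_sub (Res1 M) (Res1 N).

Definition nonproj_indec : rep_class :=
  fun M => indecomposable M /\ ~ projective M.

Definition antichain (E : rep_class) : Prop :=
  [/\ iso_closed E,
      class_sub E nonproj_indec
    & forall M N : rep, E M -> E N -> res_le M N -> rep_iso M N].

(* The first conjunct is vacuous unless E is empty: add of the empty family   *)
(* is by convention the category of projectives, not the zero category.       *)
Definition add_Res (E : rep_class) : rep_class := fun N =>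
  ((forall M : rep, ~ E M) -> projective N) /\
  ((exists M : rep, E M) ->
     add_closure (fun L => exists M : rep, E M /\ Res1 M L) N).

End Representations.

(* Main.v *)
Require Import Defs.
From HB Require Import structures.
From mathcomp Require Import all_boot all_order all_algebra.
From mathcomp Require Import lra zify.
From Stdlib Require Import Classical_Prop.

(* Every edge weighting of a tree has a potential.  This yields an            *)
(* orientation of the tree "from left to right" for which the zero relations  *)
(* are exactly the pairs of composable arrows on the same side of their       *)
(* common vertex, so strings are the left-to-right walks.  At a vertex v, the *)
(* functorial filtrations of M v coming from the two sides supply a vector    *)
(* and a linear form which extend along a string through v; together they     *)
(* define an idempotent endomorphism of M, so an indecomposable M is the      *)
(* module of that string.  A nonzero map between string modules moves both    *)
(* ends of the string in a fixed direction for orders on the left and on the  *)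
(* right ends; the resulting weight makes rep(Q,R) directed.                  *)
(* Directedness implies that an indecomposable non-projective X in Res(Y) is  *)
(* isomorphic to Y or of smaller weight, since the modules all of whose       *)
(* indecomposable summands have this property or are projective form a        *)
(* resolving class.  So Res is antisymmetric on the finite set N, and the     *)
(* antichain of C must consist of the maximal elements of N in C.             *)

(** Two facts about gentle trees carry the theorem: [tree_directed], a weight on supports that
    strictly grows along every nonzero non-isomorphism between indecomposables, and
    [tree_support_iso], by which an indecomposable is determined by its support. Both rest on
    [string_basis_exists], obtained by applying [half_walk] on the two sides of a vertex and then
    [indecomposable_idem]; the weight comes from [end_potential] and grows by [half_order].

    The rest is formal. Nonzero endomorphisms of indecomposables are invertible, so
    [nonzero_retract] replaces Krull-Schmidt arguments. By [below_class_resolving], the modules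
    whose indecomposable summands are projective or below a fixed Y form a resolving class; this
    yields [Res1_below] and [res_le_antisym]. There are finitely many supports, so every
    non-projective indecomposable of C lies under a maximal one ([maximal_above]), and the maximal
    ones generate C. Conversely, if an antichain E' generates C, every X of N in C is a summand of
    an object of some Res(M) with M in E', hence lies under M; so E' contains all maximal elements,
    and being an antichain it contains nothing else. *)

Set Implicit Arguments.
Unset Strict Implicit.
Unset Printing Implicit Defensive.
Import Order.TTheory GRing.Theory Num.Theory.
Local Open Scope ring_scope.

(** * Potentials on forests *)

Section Forest.
Variable Q : bquiver.

Definition edge_of (x y : Q) (a : arr x y) : edge Q :=
  existT (fun p : Q * Q => arr p.1 p.2) (x, y) a.

Definition step_rel (E : seq (edge Q)) : rel Q := fun x y =>
  [exists u : step Q, [&& u.1 \in E, step_source u == x & step_target u == y]].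

Lemma step_rel_sym E : symmetric (step_rel E).
Proof.
move=> x y; apply/existsP/existsP => -[[e d] /and3P[/= eE /eqP xE /eqP yE]];
  exists (e, ~~ d); rewrite /= eE; move: xE yE; rewrite /step_source /step_target /=;
  by case: d => /= -> ->; rewrite !eqxx.
Qed.

Lemma path_steps E (x : Q) p :
    path (step_rel E) x p -> uniq (x :: p) ->
  exists c : seq (step Q), [/\ map (@step_source Q) c = belast x p,
    map (@step_target Q) c = p, {subset map fst c <= E} & uniq (map fst c)].
Proof.
elim: p x => [|y p IH] x /=; first by move=> _ _; exists [::].
case/andP=> /existsP[u /and3P[uE /eqP ux /eqP uy]] pp /andP[xp up].
have [c [cs ct cE uc]] := IH y pp up.
exists (u :: c); split=> /=; rewrite ?ux ?uy ?cs ?ct //.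
  by move=> e; rewrite inE => /orP[/eqP->|/cE].
(* A later step over the same edge would visit both of its ends again, hence [x]. *)
rewrite uc andbT; apply/negP => /mapP[w wc uw].
have ws : step_source w \in y :: p.
  apply: mem_belast; rewrite -cs; exact: map_f.
have wt : step_target w \in y :: p.
  rewrite inE -ct map_f ?orbT //.
move: xp ws wt; rewrite -ux /step_source /step_target -uw.
by case: (u.2); case: (w.2) => /negP.
Qed.

Lemma path_step_belast (u : step Q) c :
  map (@step_source Q) c = belast (step_target u) (map (@step_target Q) c) ->
  path (fun u v => step_target u == step_source v) u c.
Proof. by elim: c u => //= v c IH u [-> /IH ->]; rewrite eqxx. Qed.

Hypothesis acyclic : forall c : seq (step Q), ~~ graph_cycle c.

(** A simple path through [E] between the ends of [e] would be closed by [e] into a cycle. *)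
Lemma edge_separates E (e : edge Q) :
  e \notin E -> ~~ connect (step_rel E) (tag e).2 (tag e).1.
Proof.
move=> eE; apply/negP => /connectP[p0 pp0 ep0].
move: ep0; case/shortenP: pp0 => p pp up _ ep.
have [c [cs ct cE uc]] := path_steps pp up.
have/negP := acyclic ((e, true) :: c); apply; apply/and4P; split=> //=.
- apply: path_step_belast.
  by rewrite !map_rcons cs ct /step_target /step_source /= ep belast_rcons -lastI.
- by rewrite uc andbT; apply: contra eE => /cE.
- rewrite cs /step_source /= ep.
  by rewrite -rcons_uniq -lastI.
Qed.

(** Edges are added one at a time. A new edge joins two different components of the earlier ones, so
    a constant shift on the component of its head corrects the new difference and keeps the old
    ones. *)
Lemma forest_potential (V : zmodType) (wt : edge Q -> V) :
  exists f : Q -> V, forall e, f (tag e).2 - f (tag e).1 = wt e.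
Proof.
suff [f fE] : exists f : Q -> V,
    forall e, e \in enum (edge Q) -> f (tag e).2 - f (tag e).1 = wt e.
  by exists f => e; apply: fE; rewrite mem_enum.
elim: (enum _) (enum_uniq (edge Q)) => [|e E IH] /=; first by exists (fun=> 0).
case/andP=> eE /IH[f fE].
pose C := connect (step_rel E) (tag e).2.
exists (fun x => if C x then f x + (wt e - (f (tag e).2 - f (tag e).1)) else f x).
have Ce : C (tag e).1 = false by apply/negbTE/edge_separates.
move=> e'; rewrite inE => /predU1P[->|e'E].
  rewrite Ce {1}/C connect0.
  by rewrite addrAC [X in X = _]addrC subrK.
have -> : C (tag e').2 = C (tag e').1.
  rewrite /C; apply: same_connect_r; first exact: sym_connect_sym (@step_rel_sym E).
  apply: connect1; apply/existsP; exists (e', false).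
  by rewrite /= e'E /step_source /step_target /= !eqxx.
rewrite -(fE e' e'E); case: ifP => _ //.
by move: (wt e - _) => d; rewrite opprD addrACA subrr addr0.
Qed.

End Forest.

(** * Left-to-right orientation of a gentle tree *)

(* [side a] holds when [a] leaves its source on the right and enters its     *)
(* target from the left; otherwise it leaves on the left and enters from the  *)
(* right.  [ht] counts steps to the right.                                    *)
Record orientation (Q : bquiver) := Orientation {
  side :> forall x y : Q, arr x y -> bool;
  ht : Q -> int;
  side_src : forall (x y z : Q) (a : arr x y) (b : arr x z),
    side a = side b -> Tagged (arr x) a = Tagged (arr x) b;
  side_tgt : forall (x y z : Q) (a : arr x z) (b : arr y z),
    side a = side b -> Tagged (fun u => arr u z) a = Tagged (fun u => arr u z) b;
  side_zrel : forall (x y z : Q) (a : arr x y) (b : arr y z),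
    zrel a b = (side a != side b);
  ht_arr : forall (x y : Q) (a : arr x y),
    ht y = ht x + (if side a then 1 else -1);
  no_2cycle : forall x y : Q, arr x y -> arr y x -> False
}.
Arguments ht {Q} o v.

Section Gentle.
Variable Q : bquiver.
Hypothesis gQ : gentle Q.

(** [src_side] and [tgt_side] are local signs at the two ends of an arrow, relative to one chosen
    arrow leaving the vertex. Both make the same choice there, so that relations become
    disagreements of signs; the two signs of one arrow need not agree yet. *)
Definition src_side (x y : Q) (a : arr x y) : bool :=
  if [pick b : arr_from x] is Some b then Tagged (arr x) a == b else false.

Definition tgt_side (x y : Q) (a : arr x y) : bool :=
  if [pick b : arr_from y] is Some b then ~~ zrel a (tagged b) else
  if [pick a' : arr_to y] is Some a' then Tagged (fun u => arr u y) a == a'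
  else false.

Lemma card_le1_eq (T : finType) (A : {set T}) x y :
  (#|A| <= 1)%N -> x \in A -> y \in A -> x = y.
Proof. by move=> /card_le1_eqP A1 xA yA; apply: (A1 y x). Qed.

Lemma card_le2_eq (T : finType) (x y z : T) :
  (#|T| <= 2)%N -> (x == z) = (y == z) -> x = y.
Proof.
move=> T2; case: eqVneq => [->|xz] /esym; first by move/eqP.
move=> /negbT yz; apply/eqP/negPn/negP => xy.
have : (#|[set x; y; z]| <= #|T|)%N by exact: max_card.
rewrite -setUA cardsU1 !inE negb_or xy xz cards2 yz /=.
by move=> h; have := leq_trans h T2.
Qed.

Lemma src_side_inj (x y z : Q) (a : arr x y) (b : arr x z) :
  src_side a = src_side b -> Tagged (arr x) a = Tagged (arr x) b.
Proof.
case: gQ => g1 _ _ _; rewrite /src_side; case: pickP => [c _|h _].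
  exact: card_le2_eq (g1 x).
by have := h (Tagged (arr x) a).
Qed.

Lemma tgt_side_inj (x y z : Q) (a : arr x z) (b : arr y z) :
  tgt_side a = tgt_side b ->
  Tagged (fun u => arr u z) a = Tagged (fun u => arr u z) b.
Proof.
case: gQ => _ g2 _ g4; rewrite /tgt_side; case: pickP => [c _ /negb_inj e|_].
  have [h1 h2] := g4 _ _ (tagged c).
  by case zb : (zrel b (tagged c)) e => e;
     [apply: (card_le1_eq h1) | apply: (card_le1_eq h2)]; rewrite inE /= ?e ?zb.
case: pickP => [c _|h _]; first exact: card_le2_eq (g2 z).
by have := h (Tagged (fun u => arr u z) a).
Qed.

Lemma zrel_side (x y z : Q) (a : arr x y) (b : arr y z) :
  zrel a b = (tgt_side a != src_side b).
Proof.
case: gQ => _ _ g3 _; rewrite /tgt_side /src_side.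
case: pickP => [c _|h]; last by have := h (Tagged (arr y) b).
have [h1 h2] := g3 _ _ a.
case: (eqVneq (Tagged (arr y) b) c) => [<- /=|ne]; first by case: (zrel _ _).
case: (boolP (zrel a b)) => zb; case: (boolP (zrel a (tagged c))) => zc //.
  by case/eqP: ne; apply: (card_le1_eq h1); rewrite inE.
by case/eqP: ne; apply: (card_le1_eq h2); rewrite inE.
Qed.

Hypothesis acyclic : forall c : seq (step Q), ~~ graph_cycle c.

Lemma loopless (x : Q) : arr x x -> False.
Proof.
move=> a; have [f /(_ (edge_of a))] := forest_potential acyclic (fun=> 1 : int).
by rewrite /= subrr.
Qed.

Lemma tree_no_2cycle (x y : Q) : arr x y -> arr y x -> False.
Proof.
move=> a b; have [f fE] := forest_potential acyclic (fun=> 1 : int).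
have := fE (edge_of a); have := fE (edge_of b) => /=; lia.
Qed.

(** The discrepancy between the two signs of an arrow is an edge weighting with values in [bool],
    the group of order two. Twisting all signs at each vertex by a potential makes them agree, and
    does not affect comparisons of signs at one vertex. *)
Lemma orientation_exists : inhabited (orientation Q).
Proof.
pose sw (e : edge Q) : bool := src_side (tagged e) + tgt_side (tagged e).
have [g gE] := forest_potential acyclic sw.
pose o (x y : Q) (a : arr x y) : bool := src_side a (+) g x.
have oE (x y : Q) (a : arr x y) : o x y a = tgt_side a (+) g y.
  have := gE (edge_of a); rewrite /sw /o /=.
  have -> : g y - g x = g y (+) g x by [].
  have -> : src_side a + tgt_side a = src_side a (+) tgt_side a by [].
  by case: (g x); case: (g y); case: (src_side a); case: (tgt_side a).
pose hw (e : edge Q) : int := if o _ _ (tagged e) then 1 else -1.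
have [h hE] := forest_potential acyclic hw.
constructor; exists o h.
- by move=> x y z a b /addIb /src_side_inj.
- by move=> x y z a b; rewrite !oE => /addIb /tgt_side_inj.
- move=> x y z a b; rewrite oE /o zrel_side.
  by case: (tgt_side a); case: (src_side b); case: (g y).
- by move=> x y a; have := hE (edge_of a); rewrite /hw /= => <-; rewrite addrC subrK.
- exact: tree_no_2cycle.
Qed.

End Gentle.

(** The mirror image, through which results on right halves of strings also serve left halves. *)
Definition flip (Q : bquiver) (O : orientation Q) : orientation Q.
Proof.
exists (fun x y a => ~~ O x y a) (fun x => - ht O x).
- by move=> x y z a b /negb_inj /side_src.
- by move=> x y z a b /negb_inj /side_tgt.
- by move=> x y z a b; rewrite (side_zrel O); case: (O _ _ a); case: (O _ _ b).
- by move=> x y a; rewrite (ht_arr O a); case: (O _ _ a) => /=; lia.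
- exact: no_2cycle.
Defined.

Section Links.
Variables (Q : bquiver) (O : orientation Q).

(** One step to the right, whichever way its arrow points. *)
Definition link : rel Q := fun x y =>
  [exists a : arr x y, O x y a] || [exists a : arr y x, ~~ O y x a].

Lemma linkP x y : link x y ->
  (exists a : arr x y, O x y a) \/ (exists a : arr y x, ~~ O y x a).
Proof. by case/orP => /existsP; [left|right]. Qed.

Lemma link_out (x y : Q) (a : arr x y) : O x y a -> link x y.
Proof. by move=> oa; apply/orP; left; apply/existsP; exists a. Qed.

Lemma link_in (x y : Q) (a : arr x y) : ~~ O x y a -> link y x.
Proof. by move=> oa; apply/orP; right; apply/existsP; exists a. Qed.

Lemma ht_link x y : link x y -> ht O y = ht O x + 1.
Proof.
by case/linkP=> -[a oa]; have := ht_arr O a; rewrite ?oa ?(negbTE oa); lia.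
Qed.

Lemma ht_path v p x : path link v p -> x \in p -> ht O v < ht O x.
Proof.
elim: p v => //= y p IH v /andP[/ht_link hy pp]; rewrite inE => /predU1P[->|xp].
  by rewrite hy; lia.
by have := IH _ pp xp; lia.
Qed.

Lemma ht_path_le v p x : path link v p -> x \in v :: p -> ht O v <= ht O x.
Proof.
by move=> pp; rewrite inE => /predU1P[->//|xp]; apply/ltW/(ht_path pp xp).
Qed.

Lemma ht_path_last v p x : path link v p -> x \in v :: p ->
  ht O x <= ht O (last v p).
Proof.
elim: p v => [|y p IH] v /=; first by rewrite inE => _ /eqP->.
case/andP=> /ht_link hy pp; rewrite inE => /predU1P[->|]; last exact: IH.
apply: le_trans (ht_path_le pp (mem_last y p)); rewrite hy; lia.
Qed.

Lemma ht_path_inj v p x y : path link v p -> x \in v :: p -> y \in v :: p ->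
  ht O x = ht O y -> x = y.
Proof.
elim: p v => [|z p IH] v; first by rewrite !inE => _ /eqP-> /eqP->.
move=> pp; rewrite inE => /predU1P[->|xp]; rewrite inE => /predU1P[->|yp] //.
- by have := ht_path pp yp; lia.
- by have := ht_path pp xp; lia.
by apply: IH xp yp; case/andP: pp.
Qed.

Lemma path_mem_ind (P : Q -> Prop) v p : path link v p -> P v ->
  (forall x y, x \in v :: p -> y \in v :: p -> link x y -> P x -> P y) ->
  forall x, x \in v :: p -> P x.
Proof.
elim: p v => [|y p IH] v /=; first by move=> _ Pv _ x; rewrite inE => /eqP->.
case/andP=> vy pp Pv step x; rewrite inE => /predU1P[->//|]; apply: IH => //.
  by apply: step Pv; rewrite ?inE ?eqxx ?orbT.
by move=> u w uy wy; apply: step; rewrite inE ?uy ?wy orbT.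
Qed.

(* The weight of a step halves at each step to the right, so that along any   *)
(* walk the first step outweighs all the others together.                     *)
Lemma end_potential : (forall c : seq (step Q), ~~ graph_cycle c) ->
  exists rho : Q -> rat,
    (forall v y p (b : arr v y), path link y p -> O v y b ->
       rho (last y p) < rho v) /\
    (forall v y p (a : arr y v), path link y p -> ~~ O y v a ->
       rho v < rho (last y p)).
Proof.
move=> acyclic.
pose w (x : Q) : rat := 2%:R ^ (- ht O x).
have w_gt0 x : 0 < w x by rewrite /w exprz_gt0.
have w_link x y : link x y -> w x = w y + w y.
  move=> /ht_link xy; rewrite /w xy opprD expfzDr ?pnatr_eq0 // -mulrDr.
  have -> : (2%:R : rat) ^ (- 1) + 2%:R ^ (-1) = 1 by rewrite exprN1; lra.
  by rewrite mulr1.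
(* A step to the right lowers the potential by the weight of its left end when it follows its arrow,
   and raises it by that weight otherwise. Thus, among walks from [v], starting along an arrow ends
   lower than stopping, and starting against one ends higher. *)
pose wt (e : edge Q) : rat :=
  - (if O _ _ (tagged e) then w (tag e).1 else w (tag e).2).
have [rho rhoE] := forest_potential acyclic wt.
have rho_out (x y : Q) (a : arr x y) : O x y a -> rho y = rho x - w x.
  by move=> oa; have := rhoE (edge_of a); rewrite /wt /= oa; lra.
have rho_in (x y : Q) (a : arr x y) : ~~ O x y a -> rho x = rho y + w y.
  by move=> oa; have := rhoE (edge_of a); rewrite /wt /= (negbTE oa); lra.
(* The weights along the walk are a geometric series, with sum less than twice its first term. *)
have bound y p : path link y p ->
    rho y - (w y + w y) < rho (last y p) < rho y + (w y + w y).
  elim: p y => [|z p IH] y /=; first by have := w_gt0 y; lra.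
  case/andP=> yz pp; have := IH _ pp; rewrite (w_link _ _ yz).
  have wz := w_gt0 z.
  case/linkP: (yz) => -[a oa].
    by rewrite (rho_out _ _ _ oa) (w_link _ _ yz); lra.
  by rewrite (rho_in _ _ _ oa) (w_link _ _ yz); lra.
exists rho; split=> v y p a pp oa.
  have := bound _ _ pp; rewrite (rho_out _ _ _ oa) (w_link _ _ (link_out oa)).
  by have := w_gt0 y; lra.
have := bound _ _ pp; rewrite (rho_in _ _ _ oa) (w_link _ _ (link_in oa)).
by have := w_gt0 y; lra.
Qed.

End Links.

(** * Extending vectors and linear forms along a half-string *)

Section LinearAlgebra.
Variable K : fieldType.

Lemma lker_projection (V : vectType K) (H : {vspace V}) :
  exists f : 'Hom(V, V), lker f = H.
Proof.
exists (\1 - projv H)%VF; apply/vspaceP => u.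
rewrite memv_ker add_lfunE opp_lfunE id_lfunE subr_eq0.
apply/eqP/idP => [->|]; first exact: memv_proj.
by move/projv_id.
Qed.

Lemma lfun_factor (V W X : vectType K) (f : 'Hom(V, W)) (g : 'Hom(V, X)) :
  (lker f <= lker g)%VS -> exists k : 'Hom(W, X), (k \o f)%VF = g.
Proof.
move=> /subvP fg; exists (g \o f^-1)%VF; apply/lfunP => u; rewrite !comp_lfunE.
apply/eqP; rewrite -subr_eq0 -linearB /= -memv_ker; apply: fg.
by rewrite memv_ker linearB /= limg_lfunVK ?subrr // memv_img ?memvf.
Qed.

Lemma functional_sep (V : vectType K) (H : {vspace V}) m :
  m \notin H -> exists xi : 'Hom(V, K^o), (H <= lker xi)%VS /\ xi m = 1.
Proof.
move=> mH; have [f fH] := lker_projection H.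
have fm : f m != 0 by rewrite -memv_ker fH.
have fr : free [tuple f m] by rewrite seq1_free.
exists (linfun (coord [tuple f m] ord0 : V -> K^o) \o f)%VF; split.
  apply/subvP => u; rewrite -fH !memv_ker comp_lfunE => /eqP->.
  by rewrite linear0.
rewrite comp_lfunE lfunE /=.
by have := coord_free ord0 ord0 fr => /= ->.
Qed.

Lemma subvPnot (V : vectType K) (U W : {vspace V}) :
  ~~ (U <= W)%VS -> exists2 u, u \in U & u \notin W.
Proof. by case/subvPn => u uU uW; exists u. Qed.

End LinearAlgebra.

Section HalfWalk.
Variables (K : fieldType) (Q : bquiver) (O : orientation Q) (M : rep K Q).
Hypothesis loopless : forall x : Q, arr x x -> False.

(* Partial morphisms from, respectively to, the string module of the walk [s] *)
(* starting at [v]: nothing is required of arrows on the left of [v].         *)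
Definition sec (v : Q) (s : seq Q) (m : forall x, M x) : Prop :=
  (forall x, x \notin s -> m x = 0) /\
  forall (x y : Q) (a : arr x y), x \in s -> (x != v) || O x y a ->
    rep_map M a (m x) = m y.

Definition cosec (v : Q) (s : seq Q) (xi : forall x, 'Hom(M x, K^o)) : Prop :=
  (forall x, x \notin s -> xi x = 0) /\
  forall (x y : Q) (a : arr x y), y \in s -> (y != v) || ~~ O x y a ->
    (xi y \o rep_map M a)%VF = xi x.

Lemma zrel_kill (x y z : Q) (a : arr x y) (b : arr y z) u :
  O x y a != O y z b -> rep_map M b (rep_map M a u) = 0.
Proof.
by rewrite -(side_zrel O) => /(rep_zrel M) ab; rewrite -comp_lfunE ab zero_lfunE.
Qed.

Lemma cons_link_uniq v y p x : path (link O) v (y :: p) -> x \in y :: p ->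
  (ht O x <= ht O v + 1) -> x = y.
Proof.
case/andP=> /ht_link hy pp xp hx.
apply: (ht_path_inj pp) => //; first exact: mem_head.
by have := ht_path_le pp xp; lia.
Qed.

Lemma notin_low v p x : path (link O) v p -> ht O x < ht O v -> x \notin v :: p.
Proof. by move=> pp xv; apply/negP => /(ht_path_le pp); lia. Qed.


(** Arrows with different ends have different types, so uniqueness of the arrow on a given side is
    packaged as an induction principle on the pair of end and arrow. *)
Lemma side_src_ind (x y : Q) (a : arr x y) (P : forall z, arr x z -> Prop) :
  P y a -> forall z (b : arr x z), O x y a = O x z b -> P z b.
Proof.
move=> Pa z b /side_src e.
by have : P (tag (Tagged (arr x) b)) (tagged (Tagged (arr x) b)) by rewrite -e.
Qed.

Lemma side_tgt_ind (x y : Q) (a : arr x y) (P : forall z, arr z y -> Prop) :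
  P x a -> forall z (b : arr z y), O x y a = O z y b -> P z b.
Proof.
move=> Pa z b /side_tgt e.
pose T := Tagged (fun u => arr u y).
by have : P (tag (T z b)) (tagged (T z b)) by rewrite /T -e.
Qed.

Lemma arr_neq (x y : Q) : arr x y -> x != y.
Proof. by move=> a; apply/eqP => e; move: a; rewrite e; apply: loopless. Qed.

Lemma ht_arr_le (x y : Q) (a : arr x y) :
  ht O y <= ht O x + 1 /\ ht O x <= ht O y + 1.
Proof. by have := ht_arr O a; case: ifP => _; lia. Qed.

(** The new conditions concern [b] itself and arrows leaving [y] on the left. The latter compose to
    zero with [b], and they end below [y], where the section vanishes. *)
Lemma sec_out v y p (b : arr v y) m' m : path (link O) v (y :: p) -> O v y b ->
  sec y (y :: p) m' -> rep_map M b m = m' y -> sec v [:: v, y & p] (dfwith m' m).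
Proof.
move=> vp ob [m0 ms] bm.
have [/ht_link hy pp] := andP vp.
have vy := arr_neq b.
split=> [x|x z c].
  by rewrite inE negb_or => /andP[xv /m0 <-]; rewrite dfwith_out // eq_sym.
rewrite inE; case: (eqVneq x v) => [xv|xv /= xp _].
  move: c; rewrite xv => c _ /= oc; have {oc} : O v y b = O v z c by rewrite ob oc.
  move: z c; apply: side_src_ind.
  by rewrite dfwith_in dfwith_out.
rewrite [dfwith m' m x]dfwith_out 1?eq_sym //.
have hc := ht_arr O c.
have hx := ht_path_le pp xp.
case: (eqVneq z v) => [zv|zv].
  have xy : x = y by apply: (cons_link_uniq vp xp); rewrite -zv; have [] := ht_arr_le c.
  by case: (no_2cycle O b); rewrite -xy -zv.
rewrite dfwith_out 1?eq_sym //.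
case: (boolP ((x != y) || O x z c)) => [|/norP[/negPn/eqP xy oc]]; first exact: ms.
move: c oc hc; rewrite xy => c oc hc.
rewrite -bm (zrel_kill (a := b)) ?ob ?(negbTE oc) //.
by rewrite m0 //; apply: (notin_low pp); rewrite hc (negbTE oc); lia.
Qed.

(** An arrow leaving [v] on the right composes to zero with [a], and its end is off the walk; the
    only arrow leaving [y] on the left is [a]. *)
Lemma sec_in v y p (a : arr y v) m' m : path (link O) v (y :: p) -> ~~ O y v a ->
  sec y (y :: p) m' -> rep_map M a (m' y) = m -> sec v [:: v, y & p] (dfwith m' m).
Proof.
move=> vp oa [m0 ms] am.
have [/ht_link hy pp] := andP vp.
have yv := arr_neq a.
split=> [x|x z c].
  by rewrite inE negb_or => /andP[xv /m0 <-]; rewrite dfwith_out // eq_sym.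
have hc := ht_arr O c.
rewrite inE; case: (eqVneq x v) => [xv|xv /= xp _].
  move: c hc; rewrite xv => c hc _ /= oc.
  rewrite dfwith_in -am (zrel_kill (a := a)) ?oc ?(negbTE oa) //.
  rewrite dfwith_out ?arr_neq //.
  have [zy|] := eqVneq z y; first by case: (no_2cycle O a); rewrite -zy.
  move=> zy; rewrite m0 //; apply/negP => zp; case/eqP: zy.
  by apply: (cons_link_uniq vp zp); rewrite hc oc.
rewrite [dfwith m' m x]dfwith_out 1?eq_sym //.
have hx := ht_path_le pp xp.
have [xy|xy] := eqVneq x y; last first.
  have zv : z != v.
    apply: contra xy => /eqP zv; apply/eqP; apply: (cons_link_uniq vp xp).
    by rewrite -zv; have [] := ht_arr_le c.
  by rewrite dfwith_out 1?eq_sym //; apply: ms; rewrite ?xy.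
move: c hc xp; rewrite xy => c hc yp.
case: (boolP (O y z c)) => oc.
  have zv : z != v by apply/eqP => zv; move: hc; rewrite oc zv; lia.
  by rewrite dfwith_out 1?eq_sym //; apply: ms; rewrite ?oc ?orbT.
have {oc} : O y v a = O y z c by rewrite (negbTE oa) (negbTE oc).
by move: z c {hc}; apply: side_src_ind; rewrite dfwith_in.
Qed.

(** Dual to [sec_out]: arrows entering [y] from the left compose to zero with [a]. In the same way
    [cosec_out] is dual to [sec_in]. *)
Lemma cosec_in v y p (a : arr y v) xi' xi :
    path (link O) v (y :: p) -> ~~ O y v a ->
    cosec y (y :: p) xi' -> (xi \o rep_map M a)%VF = xi' y ->
  cosec v [:: v, y & p] (dfwith xi' xi).
Proof.
move=> vp oa [m0 ms] am.
have [/ht_link hy pp] := andP vp.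
have yv := arr_neq a.
split=> [x|x z c].
  by rewrite inE negb_or => /andP[xv /m0 <-]; rewrite dfwith_out // eq_sym.
have hc := ht_arr O c.
rewrite inE; case: (eqVneq z v) => [zv|zv /= zp _].
  move: c hc; rewrite zv => c hc _ /= oc; rewrite dfwith_in.
  have {oc} : O y v a = O x v c by rewrite (negbTE oa) (negbTE oc).
  by move: x c {hc}; apply: side_tgt_ind; rewrite dfwith_out // eq_sym.
rewrite [dfwith xi' xi z]dfwith_out 1?eq_sym //.
have hz := ht_path_le pp zp.
case: (eqVneq x v) => [xv|xv].
  have zy : z = y by apply: (cons_link_uniq vp zp); rewrite -xv; have [] := ht_arr_le c.
  by case: (no_2cycle O a); rewrite -xv -zy.
rewrite dfwith_out 1?eq_sym //.
case: (boolP ((z != y) || ~~ O x z c)) => [|/norP[/negPn/eqP zy /negPn oc]].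
  exact: ms.
move: c oc hc; rewrite zy => c oc hc.
rewrite [xi' x]m0; last by apply: (notin_low pp); rewrite hc oc ltrDl ltr01.
rewrite -am; apply/lfunP => u; rewrite !comp_lfunE zero_lfunE.
by rewrite (zrel_kill (a := c)) ?linear0 // oc (negbTE oa).
Qed.

Lemma cosec_out v y p (b : arr v y) xi' xi :
    path (link O) v (y :: p) -> O v y b ->
    cosec y (y :: p) xi' -> (xi' y \o rep_map M b)%VF = xi ->
  cosec v [:: v, y & p] (dfwith xi' xi).
Proof.
move=> vp ob [m0 ms] bm.
have [/ht_link hy pp] := andP vp.
have vy := arr_neq b.
split=> [x|x z c].
  by rewrite inE negb_or => /andP[xv /m0 <-]; rewrite dfwith_out // eq_sym.
have hc := ht_arr O c.
rewrite inE; case: (eqVneq z v) => [zv|zv /= zp _].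
  move: c hc; rewrite zv => c hc _ /= oc.
  rewrite dfwith_in -bm dfwith_out; last by rewrite eq_sym arr_neq.
  rewrite [xi' x]m0; last first.
    apply/negP => xp; apply: (no_2cycle O b).
    have xy : x = y by apply: (cons_link_uniq vp xp); have [] := ht_arr_le c.
    by rewrite -xy.
  apply/lfunP => u; rewrite !comp_lfunE zero_lfunE.
  by rewrite (zrel_kill (a := c)) ?linear0 // ob (negbTE oc).
rewrite [dfwith xi' xi z]dfwith_out 1?eq_sym //.
have hz := ht_path_le pp zp.
have [zy|zy] := eqVneq z y; last first.
  have xv : x != v.
    apply: contra zy => /eqP xv; apply/eqP; apply: (cons_link_uniq vp zp).
    by rewrite -xv; have [] := ht_arr_le c.
  by rewrite dfwith_out 1?eq_sym //; apply: ms; rewrite ?zy.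
move: c hc zp; rewrite zy => c hc yp.
case: (boolP (O x y c)) => oc; last first.
  have xv : x != v.
    by apply/eqP => xv; move: hc; rewrite (negbTE oc) xv; lia.
  by rewrite dfwith_out 1?eq_sym //; apply: ms; rewrite ?oc ?orbT.
have {oc} : O v y b = O x y c by rewrite ob oc.
by move: x c {hc}; apply: side_tgt_ind; rewrite dfwith_in.
Qed.

(** [U] bounds the values at [v] of partial morphisms from the half-string, and the annihilator of
    [H] those of partial morphisms to it. *)
Definition extends v p (U H : {vspace M v}) : Prop :=
  (forall m, m \in U -> exists mm, sec v (v :: p) mm /\ mm v = m) /\
  (forall xi : 'Hom(M v, K^o), (H <= lker xi)%VS ->
     exists xx, cosec v (v :: p) xx /\ xx v = xi).

Lemma extends_nil v (U H : {vspace M v}) :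
    (forall y (b : arr v y), O v y b -> (U <= lker (rep_map M b))%VS) ->
    (forall x (a : arr x v), ~~ O x v a -> (limg (rep_map M a) <= H)%VS) ->
  extends [::] U H.
Proof.
move=> Ub aH; split=> [m mU|xi Hxi].
  exists (dfwith (fun x => 0 : M x) m); rewrite dfwith_in; split=> //; split=> [x|x y a].
    by rewrite inE => xv; rewrite dfwith_out // eq_sym.
  rewrite inE => /eqP xv; move: a; rewrite xv eqxx /= => a oa.
  rewrite dfwith_in dfwith_out ?arr_neq //.
  by apply/eqP; rewrite -memv_ker; apply: subvP mU; apply: Ub.
exists (dfwith (fun x => 0 : 'Hom(M x, K^o)) xi); rewrite dfwith_in.
split=> //; split=> [x|x y a].
  by rewrite inE => xv; rewrite dfwith_out // eq_sym.
rewrite inE => /eqP yv; move: a; rewrite yv eqxx /= => a oa.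
rewrite dfwith_in dfwith_out; last by rewrite eq_sym arr_neq.
apply/lfunP => u; rewrite comp_lfunE zero_lfunE; apply/eqP.
rewrite -memv_ker; apply: subvP Hxi _ _; apply: subvP (aH _ _ oa) _ _.
by rewrite memv_img ?memvf.
Qed.


Lemma extends_out v y p (b : arr v y) (U H : {vspace M y}) :
    path (link O) v (y :: p) -> O v y b -> extends p U H ->
  extends (y :: p) (rep_map M b @^-1: U) (rep_map M b @^-1: H).
Proof.
move=> vp ob [eU eH]; split=> [m|xi Hxi].
  rewrite -memv_preim => /eU[mm [ms mv]]; exists (dfwith mm m).
  by rewrite dfwith_in; split=> //; apply: (sec_out vp ob ms).
(* A form vanishing on the preimage of [H] factors through [b] followed by a map with kernel [H]. *)
have [f fH] := lker_projection H.
have [k kE] : exists k : 'Hom(M y, K^o), (k \o (f \o rep_map M b))%VF = xi.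
  apply: lfun_factor; apply: subv_trans Hxi; apply/subvP => u.
  by rewrite memv_ker comp_lfunE -memv_ker fH memv_preim.
have Hk : (H <= lker (k \o f))%VS.
  apply/subvP => u; rewrite -fH !memv_ker comp_lfunE => /eqP->.
  by rewrite linear0.
have [xx [xs xy]] := eH _ Hk.
exists (dfwith xx xi); rewrite dfwith_in; split=> //.
by apply: (cosec_out vp ob xs); rewrite xy -comp_lfunA.
Qed.

Lemma extends_in v y p (a : arr y v) (U H : {vspace M y}) :
    path (link O) v (y :: p) -> ~~ O y v a -> extends p U H ->
  extends (y :: p) (rep_map M a @: U) (rep_map M a @: H).
Proof.
move=> vp oa [eU eH]; split=> [m /memv_imgP[u uU ->]|xi Hxi].
  have [mm [ms my]] := eU _ uU; exists (dfwith mm (rep_map M a u)).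
  by rewrite dfwith_in; split=> //; apply: (sec_in vp oa ms); rewrite my.
have Hx : (H <= lker (xi \o rep_map M a))%VS.
  apply/subvP => u uH; rewrite memv_ker comp_lfunE -memv_ker.
  by apply: subvP Hxi _ _; apply: memv_img.
have [xx [xs xy]] := eH _ Hx.
exists (dfwith xx xi); rewrite dfwith_in; split=> //.
by apply: (cosec_in vp oa xs); rewrite xy.
Qed.

(* The pairs (H, U') produced here are consecutive terms of the functorial    *)
(* filtration of [M v] given by the walks leaving v on one side, chosen where *)
(* this filtration jumps on the subquotient U / G.                            *)
Lemma half_walk v (G U : {vspace M v}) : (G <= U)%VS -> ~~ (U <= G)%VS ->
  exists p (U' H : {vspace M v}),
    [/\ path (link O) v p, (U' <= U)%VS, ~~ (U' <= G)%VS, (U :&: H <= G)%VS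
      & extends p U' H].
Proof.
have [n] := ubnP #|[set x | ht O v < ht O x]|.
elim: n v G U => // n IH v G U vn GU UG.
have descend y : link O v y -> (#|[set x | (ht O y < ht O x)%R]| < n)%N.
  move=> /ht_link hy.
  apply: leq_trans (_ : _ < #|[set x | (ht O v < ht O x)%R]|)%N _ => //.
  apply: proper_card; apply/properP; split.
    by apply/subsetP => x; rewrite !inE hy; lia.
  by exists y; rewrite !inE hy ?ltxx //; lia.
(* If the image of the arrow entering from the right meets [U] outside [G], the walk goes on against
   this arrow, with the preimages of [G] and [U]. *)
have [/existsP[[x a] /= /andP[oa aG]]|noin] := boolP [exists a : arr_to v,
    ~~ O _ _ (tagged a) && ~~ (U :&: limg (rep_map M (tagged a)) <= G)%VS].
  have vx := link_in oa.
  have [||p [U1 [H1 [pp U1U U1G UH1 ext]]]] :=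
    IH x (rep_map M a @^-1: G)%VS (rep_map M a @^-1: U)%VS (descend _ vx).
  - exact: lpreimS.
  - have [u] := subvPnot aG.
    rewrite memv_cap => /andP[uU /memv_imgP[w _ uw]] uG.
    apply/negP => /subvP/(_ w); rewrite -!memv_preim -uw => /(_ uU).
    by apply/negP.
  exists (x :: p), (rep_map M a @: U1)%VS, (rep_map M a @: H1)%VS; split.
  - by rewrite /= vx.
  - apply/subvP => u /memv_imgP[w wU ->].
    by rewrite memv_preim; apply: subvP U1U _ wU.
  - have [w wU wG] := subvPnot U1G; apply/negP => /subvP/(_ (rep_map M a w)).
    by rewrite memv_img // => /(_ isT); rewrite memv_preim; apply/negP.
  - apply/subvP => u; rewrite memv_cap => /andP[uU /memv_imgP[w wH uw]].
    rewrite uw memv_preim; apply: subvP UH1 _ _.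
    by rewrite memv_cap wH -memv_preim -uw uU.
  - by apply: extends_in => //=; rewrite vx.
(* If the arrow leaving on the right is injective on the quotient of [U] by [G], the walk goes on
   along it, with the images of [G] and [U]. *)
have [/existsP[[y b] /= /andP[ob bG]]|noout] := boolP [exists b : arr_from v,
    O _ _ (tagged b) && (U :&: lker (rep_map M (tagged b)) <= G)%VS].
  have vy := link_out ob.
  have bK u w : u \in U -> w \in G -> rep_map M b u = rep_map M b w -> u \in G.
    move=> uU wG uw; rewrite -(subrK w u) rpredD //.
    apply: subvP bG _ _; rewrite memv_cap memv_ker linearB /= uw subrr eqxx.
    by rewrite rpredB //; apply: subvP GU _ wG.
  have [||p [U1 [H1 [pp U1U U1G UH1 ext]]]] :=
    IH y (rep_map M b @: G)%VS (rep_map M b @: U)%VS (descend _ vy).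
  - exact: limgS.
  - have [u uU uG] := subvPnot UG; apply/negP => /subvP/(_ (rep_map M b u)).
    rewrite memv_img // => /(_ isT) /memv_imgP[w wG uw].
    by case/negP: uG; apply: bK uw.
  exists (y :: p), (U :&: rep_map M b @^-1: U1)%VS, (rep_map M b @^-1: H1)%VS.
  split.
  - by rewrite /= vy.
  - exact: capvSl.
  - have [w wU wG] := subvPnot U1G.
    have /memv_imgP[u uU wu] := subvP U1U _ wU.
    apply/negP => /subvP/(_ u); rewrite memv_cap uU -memv_preim -wu wU.
    by move=> /(_ isT) uG; case/negP: wG; rewrite wu memv_img.
  - apply/subvP => u; rewrite memv_cap -memv_preim => /andP[uU uH].
    have /memv_imgP[w wG uw] : rep_map M b u \in (rep_map M b @: G)%VS.
      by apply: subvP UH1 _ _; rewrite memv_cap uH memv_img.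
    exact: bK uw.
  - have [|eU eH] := extends_out (p := p) (v := v) (b := b) _ ob ext.
      by rewrite /= vy.
    by split=> // m; rewrite memv_cap => /andP[_ /eU].
(* Otherwise the walk stops: [H] is the image of the arrow entering from the right, or 0, and [U] is
   cut with the kernel of the arrow leaving on the right, if there is one. *)
have [H UH aH] : exists2 H, (U :&: H <= G)%VS &
    forall x (a : arr x v), ~~ O x v a -> (limg (rep_map M a) <= H)%VS.
  have [/existsP[[x a] /= oa]|no] := boolP [exists a : arr_to v, ~~ O _ _ (tagged a)].
    exists (limg (rep_map M a)).
      move/existsPn: noin => /(_ (Tagged (fun u => arr u v) a)) /=.
      by rewrite oa negbK.
    move=> z c oc; have {oc} : O x v a = O z v c by rewrite (negbTE oa) (negbTE oc).
    by move: z c; apply: side_tgt_ind.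
  exists 0%VS; first by rewrite capv0 sub0v.
  by move=> x a oa; move/existsPn: no => /(_ (Tagged (fun u => arr u v) a)); rewrite oa.
have [L UL bL] : exists2 L, ~~ (U :&: L <= G)%VS &
    forall y (b : arr v y), O v y b -> (L <= lker (rep_map M b))%VS.
  have [/existsP[[y b] /= ob]|no] := boolP [exists b : arr_from v, O _ _ (tagged b)].
    exists (lker (rep_map M b)).
      by move/existsPn: noout => /(_ (Tagged (arr v) b)) /=; rewrite ob.
    move=> z c oc; have {oc} : O v y b = O v z c by rewrite ob oc.
    by move: z c; apply: side_src_ind.
  exists fullv; first by rewrite capvf.
  by move=> y b ob; move/existsPn: no => /(_ (Tagged (arr v) b)); rewrite ob.
exists [::], (U :&: L)%VS, H; split=> //; first exact: capvSl.
apply: extends_nil => // y b ob; apply: subv_trans (bL _ _ ob).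
exact: capvSr.
Qed.

End HalfWalk.

(** * Retracts and decompositions of representations *)

Lemma linfun_linear (K : fieldType) (V W : vectType K) (f : V -> W) :
  linear f -> linfun f =1 f.
Proof.
move=> lf.
pose g := GRing.isLinear.Build K _ _ _ f lf.
pose h : {linear _ -> _} := HB.pack f g.
exact: (lfunE h).
Qed.

Section Products.
Variables (K : fieldType) (V W X : vectType K).

Definition lpair (f : 'Hom(V, W)) (g : 'Hom(V, X)) : 'Hom(V, (W * X)%type) :=
  linfun (fun u => (f u, g u)).

Lemma lpairE f g u : lpair f g u = (f u, g u).
Proof. by rewrite linfun_linear // => c v w; rewrite !linearP. Qed.

Definition lfst : 'Hom((W * X)%type, W) := linfun fst.
Definition lsnd : 'Hom((W * X)%type, X) := linfun snd.

Lemma lfstE u : lfst u = u.1.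
Proof. by rewrite linfun_linear. Qed.

Lemma lsndE u : lsnd u = u.2.
Proof. by rewrite linfun_linear. Qed.

Lemma dim_prod : \dim {: (W * X)%type} = (\dim {: W} + \dim {: X})%N.
Proof. by rewrite !dimvf. Qed.

End Products.
Arguments lfst {K W X}.
Arguments lsnd {K W X}.

Section Category.
Variables (K : fieldType) (Q : bquiver).
Implicit Types L M N P X Y Z : rep K Q.

Definition is_hom M N (f : forall x, 'Hom(M x, N x)) : Prop :=
  forall (x y : Q) (a : arr x y),
    (f y \o rep_map M a)%VF = (rep_map N a \o f x)%VF.

Lemma rhomE M N (f : rhom M N) (x y : Q) (a : arr x y) u :
  f y (rep_map M a u) = rep_map N a (f x u).
Proof. by rewrite -!comp_lfunE rhom_comm. Qed.

Lemma is_homP M N (f : forall x, 'Hom(M x, N x)) :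
  (forall x y (a : arr x y) u, f y (rep_map M a u) = rep_map N a (f x u)) ->
  is_hom f.
Proof. by move=> h x y a; apply/lfunP => u; rewrite !comp_lfunE. Qed.

Lemma is_hom_id M : is_hom (fun x => \1%VF : 'Hom(M x, M x)).
Proof. by apply: is_homP => x y a u; rewrite !id_lfunE. Qed.

Lemma is_hom_comp L M N (g : rhom M N) (f : rhom L M) :
  is_hom (fun x => g x \o f x)%VF.
Proof. by apply: is_homP => x y a u; rewrite !comp_lfunE !rhomE. Qed.

Lemma is_homB M N (f g : rhom M N) : is_hom (fun x => f x - g x).
Proof.
by apply: is_homP => x y a u; rewrite !add_lfunE !opp_lfunE !rhomE linearB.
Qed.

Lemma is_hom_sum M N (I : finType) (B : pred I) (f : I -> rhom M N) :
  is_hom (fun x => \sum_(i | B i) f i x).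
Proof.
apply: is_homP => x y a u; rewrite !sum_lfunE linear_sum.
by apply: eq_bigr => i _; rewrite rhomE.
Qed.

Definition rid M : rhom M M := RHom (@is_hom_id M).
Definition rcomp L M N (g : rhom M N) (f : rhom L M) : rhom L N :=
  RHom (is_hom_comp g f).
Definition rsub M N (f g : rhom M N) : rhom M N := RHom (is_homB f g).
Definition rsum M N (I : finType) (B : pred I) (f : I -> rhom M N) : rhom M N :=
  RHom (is_hom_sum B f).

Definition retract Z M : Prop :=
  exists (s : rhom Z M) (r : rhom M Z), forall x, (r x \o s x)%VF = \1%VF.

Lemma retract_refl M : retract M M.
Proof. by exists (rid M), (rid M) => x; rewrite comp_lfun1l. Qed.

Lemma retract_trans L M N : retract L M -> retract M N -> retract L N.
Proof.
move=> [s [r rs]] [s' [r' rs']]; exists (rcomp s' s), (rcomp r r') => x /=.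
by rewrite -comp_lfunA [(r' x \o _)%VF]comp_lfunA rs' comp_lfun1l.
Qed.

Lemma rep_iso_refl M : rep_iso M M.
Proof. by exists (rid M), (rid M) => x /=; rewrite comp_lfun1l. Qed.

Lemma rep_iso_sym M N : rep_iso M N -> rep_iso N M.
Proof. by move=> [f [g fg]]; exists g, f => x; have [] := fg x. Qed.

Lemma rep_iso_trans L M N : rep_iso L M -> rep_iso M N -> rep_iso L N.
Proof.
move=> [f [g fg]] [f' [g' fg']]; exists (rcomp f' f), (rcomp g g') => x /=.
have [gf1 fg1] := fg x; have [gf2 fg2] := fg' x.
rewrite -comp_lfunA [(g' x \o _)%VF]comp_lfunA gf2 comp_lfun1l gf1.
by rewrite -comp_lfunA [(f x \o _)%VF]comp_lfunA fg1 comp_lfun1l fg2.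
Qed.

Lemma rep_iso_retract M N : rep_iso M N -> retract M N.
Proof. by move=> [f [g fg]]; exists f, g => x; have [] := fg x. Qed.

Lemma retract_dim Z M x : retract Z M -> (\dim {: Z x} <= \dim {: M x})%N.
Proof.
move=> [s [r rs]].
have s0 : lker (s x) == 0%VS.
  apply/lker0P => u v /(congr1 (r x)).
  by rewrite -!comp_lfunE rs !id_lfunE.
rewrite -(limg_dim_eq (f := s x)) ?(eqP s0) ?capv0 //.
exact: dimvS (subvf _).
Qed.

Lemma rep_iso_dim M N x : rep_iso M N -> \dim {: M x} = \dim {: N x}.
Proof.
move=> MN; apply/eqP; rewrite eqn_leq !retract_dim //; apply: rep_iso_retract => //.
exact: rep_iso_sym.
Qed.

Lemma zero_repP M x (u : M x) : zero_rep M -> u = 0.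
Proof.
move/(_ x)/eqP; rewrite dimv_eq0 => /eqP M0.
by apply/eqP; rewrite -memv0 -M0 memvf.
Qed.

Lemma zero_rep_retract Z M : retract Z M -> zero_rep M -> zero_rep Z.
Proof. by move=> ZM M0 x; apply/eqP; rewrite -leqn0 -(M0 x) retract_dim. Qed.

Lemma nonzero_rep M : ~ zero_rep M -> exists x (u : M x), u != 0.
Proof.
move=> M0; apply: NNPP => no; apply: M0 => x; apply/eqP.
rewrite dimv_eq0 -subv0; apply/subvP => u _; rewrite memv0; apply/negPn/negP => u0.
by apply: no; exists x, u.
Qed.

Lemma is_hom_inl M N :
  is_hom (N := dsum M N) (fun x => lpair \1%VF 0 : 'Hom(M x, (M x * N x)%type)).
Proof.
apply: is_homP => x y a u; rewrite /= dsum_mapE !lpairE /=.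
by rewrite !id_lfunE !zero_lfunE linear0.
Qed.

Lemma is_hom_inr M N :
  is_hom (N := dsum M N) (fun x => lpair 0 \1%VF : 'Hom(N x, (M x * N x)%type)).
Proof.
apply: is_homP => x y a u; rewrite /= dsum_mapE !lpairE /=.
by rewrite !id_lfunE !zero_lfunE linear0.
Qed.

Lemma is_hom_fst M N :
  is_hom (M := dsum M N) (fun x => lfst : 'Hom((M x * N x)%type, M x)).
Proof. by apply: is_homP => x y a u; rewrite /= dsum_mapE !lfstE. Qed.

Lemma is_hom_snd M N :
  is_hom (M := dsum M N) (fun x => lsnd : 'Hom((M x * N x)%type, N x)).
Proof. by apply: is_homP => x y a u; rewrite /= dsum_mapE !lsndE. Qed.

Definition dinl M N : rhom M (dsum M N) := RHom (@is_hom_inl M N).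
Definition dinr M N : rhom N (dsum M N) := RHom (@is_hom_inr M N).
Definition dfst M N : rhom (dsum M N) M := RHom (@is_hom_fst M N).
Definition dsnd M N : rhom (dsum M N) N := RHom (@is_hom_snd M N).

Lemma retract_dsuml M N : retract M (dsum M N).
Proof.
exists (dinl M N), (dfst M N) => x; apply/lfunP => u.
by rewrite comp_lfunE /= lpairE lfstE.
Qed.

Lemma retract_dsumr M N : retract N (dsum M N).
Proof.
exists (dinr M N), (dsnd M N) => x; apply/lfunP => u.
by rewrite comp_lfunE /= lpairE lsndE.
Qed.

Lemma dsum_id M N x :
  (dinl M N x \o dfst M N x)%VF + (dinr M N x \o dsnd M N x)%VF = \1%VF.
Proof.
apply/lfunP => -[u v]; rewrite add_lfunE !comp_lfunE /= !lpairE lfstE lsndE /=.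
by rewrite !id_lfunE !zero_lfunE; congr pair; rewrite /= ?addr0 ?add0r.
Qed.

Lemma projective_retract Z P : retract Z P -> projective P -> projective Z.
Proof.
move=> [s [r rs]] pP M N g f eg.
have [h hE] := pP _ _ g (rcomp f r) eg.
exists (rcomp h s) => x /=.
by rewrite comp_lfunA hE /= -comp_lfunA rs comp_lfun1r.
Qed.

Lemma projective_zero M : zero_rep M -> projective M.
Proof.
move=> M0 X Y g f _.
have h0 : is_hom (fun x => 0 : 'Hom(M x, X x)).
  by apply: is_homP => x y a u; rewrite !zero_lfunE linear0.
exists (RHom h0) => x; apply/lfunP => u /=.
by rewrite (zero_repP u M0) !linear0.
Qed.

Lemma projective_dsum M N : projective M -> projective N -> projective (dsum M N).
Proof.
move=> pM pN X Y g f eg.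
have [h hE] := pM _ _ g (rcomp f (dinl M N)) eg.
have [k kE] := pN _ _ g (rcomp f (dinr M N)) eg.
exists (rsum xpredT (fun b : bool =>
  if b then rcomp h (dfst M N) else rcomp k (dsnd M N))) => x /=.
rewrite big_bool /= comp_lfunDr !comp_lfunA hE kE /= -!comp_lfunA -comp_lfunDr.
by rewrite dsum_id comp_lfun1r.
Qed.

Section Subrep.
Variables (M : rep K Q) (U : forall x : Q, {vspace M x}).
Hypothesis stable : forall (x y : Q) (a : arr x y) u,
  u \in U x -> rep_map M a u \in U y.

Definition subrep_map (x y : Q) (a : arr x y) :
    'Hom(subvs_of (U x), subvs_of (U y)) :=
  linfun (fun u => vsproj (U y) (rep_map M a (vsval u))).

Lemma subrep_mapE (x y : Q) (a : arr x y) u :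
  vsval (subrep_map a u) = rep_map M a (vsval u).
Proof.
rewrite linfun_linear; last by move=> c v w; rewrite !linearP.
by rewrite vsprojK // stable // subvsP.
Qed.

Lemma subrep_zrel (x y z : Q) (a : arr x y) (b : arr y z) :
  zrel a b -> (subrep_map b \o subrep_map a)%VF = 0.
Proof.
move=> /(rep_zrel M) ab; apply/lfunP => u; apply: val_inj => /=.
by rewrite comp_lfunE !subrep_mapE -comp_lfunE ab !zero_lfunE linear0.
Qed.

Definition subrep : rep K Q :=
  @Rep K Q (fun x => subvs_of (U x) : vectType K) subrep_map subrep_zrel.

Lemma is_hom_incl :
  is_hom (M := subrep) (fun x => linfun vsval : 'Hom(subvs_of (U x), M x)).
Proof. by apply: is_homP => x y a u; rewrite !lfunE /= subrep_mapE. Qed.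

Definition subrep_incl : rhom subrep M := RHom is_hom_incl.

Lemma is_hom_proj L (f : rhom L M) : (forall x u, f x u \in U x) ->
  is_hom (N := subrep) (fun x => linfun (vsproj (U x)) \o f x)%VF.
Proof.
move=> fU; apply: is_homP => x y a u; apply: val_inj => /=.
by rewrite subrep_mapE !comp_lfunE !lfunE /= !vsprojK ?rhomE ?stable ?fU.
Qed.

Definition subrep_corestrict L (f : rhom L M) (fU : forall x u, f x u \in U x) :
  rhom L subrep := RHom (is_hom_proj fU).

Lemma subrep_corestrictE L (f : rhom L M) fU x u :
  subrep_incl x (@subrep_corestrict L f fU x u) = f x u.
Proof. by rewrite /= comp_lfunE !lfunE /= vsprojK ?fU. Qed.

Lemma subrep_incl_inj x u v : subrep_incl x u = subrep_incl x v -> u = v.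
Proof. by rewrite /= !lfunE => /val_inj. Qed.

Lemma subrep_inclP x u : subrep_incl x u \in U x.
Proof. by rewrite /= lfunE /= subvsP. Qed.

End Subrep.

(** The complement is the kernel of the retraction [r], with projection [1 - s r]. *)
Lemma retract_split Z M : retract Z M -> exists Z', rep_iso M (dsum Z Z').
Proof.
move=> [s [r rs]]; pose U x := lker (r x).
have stU x y (a : arr x y) u : u \in U x -> rep_map M a u \in U y.
  by rewrite !memv_ker rhomE => /eqP->; rewrite linear0.
have rsE x u : r x (s x u) = u by rewrite -comp_lfunE rs id_lfunE.
pose p := rsub (rid M) (rcomp s r).
have pE x u : p x u = u - s x (r x u).
  by rewrite /= add_lfunE opp_lfunE id_lfunE comp_lfunE.
have pU x u : p x u \in U x by rewrite memv_ker pE linearB /= rsE subrr.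
pose c := subrep_corestrict stU pU; pose i := subrep_incl stU.
have cE x u : i x (c x u) = p x u by apply: subrep_corestrictE.
pose f : rhom M (dsum Z (subrep stU)) := rsum xpredT (fun b : bool =>
  if b then rcomp (dinl _ _) r else rcomp (dinr _ _) c).
pose g : rhom (dsum Z (subrep stU)) M := rsum xpredT (fun b : bool =>
  if b then rcomp s (dfst _ _) else rcomp i (dsnd _ _)).
have fE x u : f x u = (r x u, c x u).
  rewrite /= sum_lfunE big_bool /= !comp_lfunE !lpairE !id_lfunE !zero_lfunE.
  by congr pair; rewrite /= ?addr0 ?add0r.
have gE x u : g x u = s x u.1 + i x u.2.
  by rewrite /= sum_lfunE big_bool /= !comp_lfunE lfstE lsndE.
exists (subrep stU), f, g => x; split; apply/lfunP => u.
  by rewrite comp_lfunE fE gE cE pE id_lfunE addrC subrK.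
case: u => u w; rewrite comp_lfunE gE fE id_lfunE /=.
have iw : r x (i x w) = 0 by apply/eqP; rewrite -memv_ker subrep_inclP.
have ru : r x (s x u + i x w) = u by rewrite linearD /= rsE iw addr0.
congr pair => //; apply: (@subrep_incl_inj _ _ stU); rewrite -/(i x) cE pE.
by rewrite /= ru addrC addKr.
Qed.

(** The image of [e] is a nonzero direct summand, so its complement vanishes. *)
Lemma indecomposable_idem M (e : rhom M M) : indecomposable M ->
    (forall x u, e x (e x u) = e x u) -> (exists x u, e x u != 0) ->
  forall x u, e x u = u.
Proof.
move=> [_ indM] ee [x0 [u0 eu0]]; pose U x := limg (e x).
have stU x y (a : arr x y) u : u \in U x -> rep_map M a u \in U y.
  by move=> /memv_imgP[w _ ->]; rewrite -rhomE memv_img ?memvf.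
have eU x u : e x u \in U x by rewrite memv_img ?memvf.
pose c := subrep_corestrict stU eU; pose i := subrep_incl stU.
have cE x u : i x (c x u) = e x u by apply: subrep_corestrictE.
have ei x u : e x (i x u) = i x u.
  by have /memv_imgP[w _ ->] := subrep_inclP u; rewrite ee.
have ci x : (c x \o i x)%VF = \1%VF.
  apply/lfunP => u; rewrite comp_lfunE id_lfunE.
  by apply: (@subrep_incl_inj _ _ stU); rewrite -/(i x) cE ei.
have [Z' MZ] : exists Z', rep_iso M (dsum (subrep stU) Z').
  by apply: retract_split; exists i, c.
case: (indM _ _ MZ) => [S0|Z0].
  by move: eu0; rewrite -cE (zero_repP (c x0 u0) S0) linear0 eqxx.
move=> x u; apply/eqP; rewrite eq_sym; suff : u \in U x.
  by case/memv_imgP => w _ ->; rewrite ee.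
suff /eqP -> : U x == fullv by rewrite memvf.
have := rep_iso_dim x MZ; rewrite /= dim_prod Z0 addn0 => dM.
by rewrite eqEdim subvf dM dimvf; apply: leqnn.
Qed.

Definition total_dim M : nat := \sum_x \dim {: M x}.

Lemma total_dim_eq0 M : total_dim M = 0%N -> zero_rep M.
Proof.
move=> /eqP; rewrite sum_nat_eq0 => /forallP M0 x.
by have /implyP/(_ isT)/eqP := M0 x.
Qed.

Lemma total_dim_dsum M N : total_dim (dsum M N) = (total_dim M + total_dim N)%N.
Proof. by rewrite -big_split; apply: eq_bigr => x _; rewrite dim_prod. Qed.

Lemma rep_decomp_ind (D : rep_class K Q) : iso_closed D ->
    (forall M, zero_rep M -> D M) -> (forall M, indecomposable M -> D M) ->
    (forall M N, D M -> D N -> D (dsum M N)) ->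
  forall M, D M.
Proof.
move=> isoD D0 Dind Dsum M.
have [n] := ubnP (total_dim M); elim: n M => // n IH M Mn.
have [M0|M0] := classic (zero_rep M); first exact: D0.
have [iM|iM] := classic (indecomposable M); first exact: Dind.
have [X [Y [MXY X0 Y0]]] : exists X Y,
    [/\ rep_iso M (dsum X Y), ~ zero_rep X & ~ zero_rep Y].
  apply: NNPP => no; apply: iM; split=> // X Y MXY.
  have [X0|X0] := classic (zero_rep X); first by left.
  by right; apply: NNPP => Y0; apply: no; exists X, Y.
have dM : total_dim M = (total_dim X + total_dim Y)%N.
  by rewrite -total_dim_dsum; apply: eq_bigr => x _; apply: rep_iso_dim.
have gX : (0 < total_dim X)%N by rewrite lt0n; apply/eqP => /total_dim_eq0.
have gY : (0 < total_dim Y)%N by rewrite lt0n; apply/eqP => /total_dim_eq0.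
apply: isoD (rep_iso_sym MXY) _; apply: Dsum; apply: IH;
  rewrite -ltnS; apply: leq_trans Mn; rewrite ltnS dM.
  by rewrite -[X in (X < _)%N]addn0 ltn_add2l.
by rewrite -[X in (X < _)%N]add0n ltn_add2r.
Qed.

Record piece M := Piece {
  piece_rep : rep K Q;
  piece_in : rhom piece_rep M;
  piece_out : rhom M piece_rep
}.

(** The resolution of the identity is what later cuts a morphism into its components. *)
Definition decomposition M (I : finType) (p : I -> piece M) : Prop :=
  (forall i, indecomposable (piece_rep (p i)) /\ retract (piece_rep (p i)) M) /\
  forall x u, \sum_i piece_in (p i) x (piece_out (p i) x u) = u.

Lemma decomposition_exists M :
  exists (I : finType) (p : I -> piece M), decomposition p.
Proof.
move: M; apply: rep_decomp_ind.
- move=> M N MN [I [p [ind sum1]]]; have [f [g fg]] := MN.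
  exists I, (fun i => Piece (rcomp f (piece_in (p i))) (rcomp (piece_out (p i)) g)).
  split=> [i|x u] /=.
    have [? pM] := ind i; split=> //.
    exact: retract_trans pM (rep_iso_retract MN).
  have [_ fg1] := fg x; rewrite -[RHS]id_lfunE -fg1 comp_lfunE.
  rewrite -[in RHS](sum1 x (g x u)) linear_sum.
  by apply: eq_bigr => i _; rewrite !comp_lfunE.
- move=> M M0; exists void, (fun i : void => of_void (piece M) i); split=> [[]|x u].
  by rewrite [RHS](zero_repP _ M0) [LHS](zero_repP _ M0).
- move=> M iM; exists unit, (fun _ => Piece (rid M) (rid M)); split=> [_|x u] /=.
    by split=> //; apply: retract_refl.
  by rewrite big_const card_unit /= !id_lfunE addr0.
- move=> M N [I [p [pi p1]]] [J [q [qi q1]]].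
  pose pq (i : I + J) := match i with
    | inl i => Piece (rcomp (dinl M N) (piece_in (p i)))
                     (rcomp (piece_out (p i)) (dfst M N))
    | inr j => Piece (rcomp (dinr M N) (piece_in (q j)))
                     (rcomp (piece_out (q j)) (dsnd M N))
    end.
  exists (I + J)%type, pq; split=> [[i|j]|x u].
  + have [? pM] := pi i; split=> //.
    exact: retract_trans pM (retract_dsuml M N).
  + have [? qN] := qi j; split=> //.
    exact: retract_trans qN (retract_dsumr M N).
  rewrite big_sumType -[RHS]id_lfunE -dsum_id add_lfunE !comp_lfunE.
  congr (_ + _).
    rewrite -[X in _ = dinl M N x X]p1 linear_sum.
    by apply: eq_bigr => i _; rewrite !comp_lfunE.
  rewrite -[X in _ = dinr M N x X]q1 linear_sum.
  by apply: eq_bigr => i _; rewrite !comp_lfunE.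
Qed.

End Category.

(** * Indecomposable representations are string modules; directedness *)

Section Walks.
Variables (Q : bquiver) (O : orientation Q) (v : Q) (pl pr : seq Q).
Hypotheses (path_l : path (link (flip O)) v pl) (path_r : path (link O) v pr).

Definition walk_set : {set Q} := [set x | (x \in v :: pl) || (x \in v :: pr)].

Lemma left_ht x : x \in v :: pl -> ht O x <= ht O v.
Proof. by move=> /(ht_path_le path_l) /=; rewrite lerN2. Qed.

Lemma walk_right x : x \in walk_set -> ht O v <= ht O x -> x \in v :: pr.
Proof.
rewrite inE => /orP[] // xl vx; suff -> : x = v by apply: mem_head.
apply: (ht_path_inj path_l) => //; first exact: mem_head.
by congr (- _); apply/eqP; rewrite eq_le vx left_ht.
Qed.

Lemma walk_left x : x \in walk_set -> ht O x <= ht O v -> x \in v :: pl.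
Proof.
rewrite inE => /orP[] // xr vx; suff -> : x = v by apply: mem_head.
apply: (ht_path_inj path_r) => //; first exact: mem_head.
by apply/eqP; rewrite eq_le vx (ht_path_le path_r).
Qed.

Lemma walk_inj x y : x \in walk_set -> y \in walk_set -> ht O x = ht O y -> x = y.
Proof.
move=> xS yS xy; have [vx|xv] := leP (ht O v) (ht O x).
  by apply: (ht_path_inj path_r) => //; apply: walk_right; rewrite -?xy.
apply: (ht_path_inj path_l); rewrite /= ?xy //; apply: walk_left => //.
  exact: ltW.
by rewrite -xy; apply: ltW.
Qed.

Lemma walk_center : v \in walk_set.
Proof. by rewrite inE mem_head. Qed.

Lemma walk_last_right : last v pr \in walk_set.
Proof. by rewrite inE mem_last orbT. Qed.

Lemma walk_last_left : last v pl \in walk_set.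
Proof. by rewrite inE mem_last. Qed.

Lemma walk_top x : x \in walk_set -> ht O x <= ht O (last v pr).
Proof.
rewrite inE => /orP[/left_ht xv|/(ht_path_last path_r)//].
exact: le_trans xv (ht_path_le path_r (mem_last v pr)).
Qed.

Lemma walk_bot x : x \in walk_set -> ht O (last v pl) <= ht O x.
Proof.
rewrite inE => /orP[/(ht_path_last path_l)/=|xr]; first by rewrite lerN2.
apply: le_trans (ht_path_le path_r xr).
exact: left_ht (mem_last v pl).
Qed.

(** Each arrow at the string is assigned to the half whose [sec] condition governs it; only at [v]
    does this depend on the side of the arrow. *)
Lemma walk_side_src x y (a : arr x y) : x \in walk_set ->
  [/\ ht O v <= ht O x, ht O v <= ht O y & (x != v) || O x y a] \/
  [/\ ht O x <= ht O v, ht O y <= ht O v & (x != v) || ~~ O x y a].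
Proof.
move=> xS; have ha := ht_arr O a.
have [e|e|e] := ltgtP (ht O x) (ht O v).
- have -> : x != v by apply: contraTN e => /eqP->; rewrite ltxx.
  by right; split=> //; case: ifP ha => _; lia.
- have -> : x != v by apply: contraTN e => /eqP->; rewrite ltxx.
  by left; split=> //; case: ifP ha => _; lia.
- have -> /= : x == v by apply/eqP/walk_inj => //; apply: walk_center.
  case: ifP ha => oa ha; [left | right]; split=> //; lia.
Qed.

Lemma walk_side_tgt x y (a : arr x y) : y \in walk_set ->
  [/\ ht O v <= ht O x, ht O v <= ht O y & (y != v) || ~~ O x y a] \/
  [/\ ht O x <= ht O v, ht O y <= ht O v & (y != v) || O x y a].
Proof.
move=> yS; have ha := ht_arr O a.
have [e|e|e] := ltgtP (ht O y) (ht O v).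
- have -> : y != v by apply: contraTN e => /eqP->; rewrite ltxx.
  by right; split=> //; case: ifP ha => _; lia.
- have -> : y != v by apply: contraTN e => /eqP->; rewrite ltxx.
  by left; split=> //; case: ifP ha => _; lia.
- have -> /= : y == v by apply/eqP/walk_inj => //; apply: walk_center.
  case: ifP ha => oa ha; [right | left]; split=> //; lia.
Qed.

End Walks.

Definition rep_support (K : fieldType) (Q : bquiver) (M : rep K Q) : {set Q} :=
  [set x | \dim {: M x} != 0%N].

Section Strings.
Variables (K : fieldType) (Q : bquiver) (O : orientation Q).
Hypothesis acyclic : forall c : seq (step Q), ~~ graph_cycle c.
Implicit Types M N : rep K Q.

(** This presents [M] as the string module of the walk through [v]: [sm] is a morphism from that
    module, [sx] one to it, and [s_basis] says that the composite on [M] is the identity. *)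
Record string_basis M (v : Q) := StringBasis {
  sl : seq Q;
  sr : seq Q;
  sm : forall x, M x;
  sx : forall x, 'Hom(M x, K^o);
  sl_path : path (link (flip O)) v sl;
  sr_path : path (link O) v sr;
  sm_mem : forall x, (sm x != 0) = (x \in walk_set v sl sr);
  sx_out : forall x, x \notin walk_set v sl sr -> sx x = 0;
  sm_arr : forall (x y : Q) (a : arr x y), sm x != 0 -> rep_map M a (sm x) = sm y;
  sx_arr : forall (x y : Q) (a : arr x y) u, sm y != 0 ->
    sx y (rep_map M a u) = sx x u;
  s_basis : forall x u, u = sx x u *: sm x
}.

(** The right half gives [U] nonzero with [H = 0]; the left half, run inside [U], gives a nonzero
    [U'] and some [H'] meeting [U] in 0. A nonzero [m] in [U'] is therefore outside [H'], and some
    form vanishing on [H'] takes the value 1 at [m]. Both extend to either side. *)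
Lemma string_family M v (u : M v) : u != 0 ->
  exists pl pr (m : forall x, M x) (xi : forall x, 'Hom(M x, K^o)),
  let S := walk_set v pl pr in
  [/\ path (link (flip O)) v pl /\ path (link O) v pr,
      forall x, x \notin S -> m x = 0 /\ xi x = 0,
      forall x y (a : arr x y), x \in S -> rep_map M a (m x) = m y,
      forall x y (a : arr x y), y \in S -> (xi y \o rep_map M a)%VF = xi x
    & forall x, x \in S -> xi x (m x) = 1].
Proof.
move=> u0; have noloop := loopless acyclic.
have [||pr [U [H [rpath _ U0 H0 [eU eH]]]]] :=
  @half_walk K Q O M noloop v 0%VS fullv; first exact: sub0v.
  by apply: contra u0 => /subvP/(_ u (memvf u)); rewrite memv0.
have {H0} H0 : H = 0%VS by apply/eqP; rewrite -subv0 -(capfv H).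
have [|pl [U' [H' [lpath U'U U'0 UH' [eU' eH']]]]] :=
  @half_walk K Q (flip O) M noloop v 0%VS U _ U0; first exact: sub0v.
have [m mU' m0] := subvPnot U'0.
have [|xi [H'xi xim]] := @functional_sep _ _ H' m.
  apply: contra m0 => mH'; apply: subvP UH' _ _; rewrite memv_cap mH'.
  by rewrite andbT; apply: subvP U'U _ mU'.
have [mr [[mr0 mrs] mrv]] := eU m (subvP U'U _ mU').
have [ml [[ml0 mls] mlv]] := eU' m mU'.
have [|xr [[xr0 xrs] xrv]] := eH xi; first by rewrite H0 sub0v.
have [xl [[xl0 xls] xlv]] := eH' xi H'xi.
pose S := walk_set v pl pr.
(* The halves are glued by height; at the height of [v] they agree at [v] and vanish elsewhere. *)
pose mm x := if ht O v <= ht O x then mr x else ml x.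
pose xx x := if ht O v <= ht O x then xr x else xl x.
have Sr x : x \notin S -> x \notin v :: pr.
  by apply: contra => xr'; rewrite inE xr' orbT.
have Sl x : x \notin S -> x \notin v :: pl.
  by apply: contra => xl'; rewrite inE xl'.
have mmr x : ht O v <= ht O x -> mm x = mr x by rewrite /mm => ->.
have xxr x : ht O v <= ht O x -> xx x = xr x by rewrite /xx => ->.
have same x : ht O x <= ht O v -> ht O v <= ht O x ->
    x = v \/ (x \notin v :: pr /\ x \notin v :: pl).
  move=> h1 h2; have [xS|xS] := boolP (x \in S).
    left; apply: (walk_inj lpath rpath) => //; first exact: walk_center.
    by apply/eqP; rewrite eq_le h1.
  by right; rewrite Sr ?Sl.
have mml x : ht O x <= ht O v -> mm x = ml x.
  rewrite /mm; case: ifP => // h2 h1; have [->|[xr' xl']] := same x h1 h2.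
    by rewrite mrv mlv.
  by rewrite mr0 ?ml0.
have xxl x : ht O x <= ht O v -> xx x = xl x.
  rewrite /xx; case: ifP => // h2 h1; have [->|[xr' xl']] := same x h1 h2.
    by rewrite xrv xlv.
  by rewrite xr0 ?xl0.
have mmarr x y (a : arr x y) : x \in S -> rep_map M a (mm x) = mm y.
  move=> xS; have [[vx vy av]|[xv yv av]] := walk_side_src lpath rpath a xS.
    by rewrite !mmr //; apply: mrs => //; apply: (walk_right lpath xS vx).
  by rewrite !mml //; apply: mls => //; apply: (walk_left rpath xS xv).
have xxarr x y (a : arr x y) : y \in S -> (xx y \o rep_map M a)%VF = xx x.
  move=> yS; have [[vx vy av]|[xv yv av]] := walk_side_tgt lpath rpath a yS.
    by rewrite !xxr //; apply: xrs => //; apply: (walk_right lpath yS vy).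
  rewrite !xxl //; apply: xls; rewrite /= ?negbK //.
  exact: (walk_left rpath yS yv).
have vv : xx v (mm v) = 1 by rewrite mmr // xxr // mrv xrv.
(* The pairing of form and vector is constant along the walk. *)
have one x y : (exists a : arr x y, true) \/ (exists a : arr y x, true) ->
    x \in S -> y \in S -> xx x (mm x) = 1 -> xx y (mm y) = 1.
  move=> [[a _]|[a _]] xS yS <-.
    by rewrite -(xxarr _ _ a yS) comp_lfunE mmarr.
  by rewrite -(xxarr _ _ a xS) comp_lfunE mmarr.
exists pl, pr, mm, xx; split=> //.
- move=> x xS; rewrite /mm /xx.
  by case: ifP => _; rewrite ?mr0 ?ml0 ?xr0 ?xl0 ?Sl ?Sr.
- move=> x; rewrite inE => /orP[].
    apply: (path_mem_ind (P := fun x => xx x (mm x) = 1) lpath vv).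
    move=> {}x y xl' yl' /linkP xy; apply: one.
    + by case: xy => -[a _]; [left|right]; exists a.
    + by rewrite inE xl'.
    + by rewrite inE yl'.
  apply: (path_mem_ind (P := fun x => xx x (mm x) = 1) rpath vv).
    move=> {}x y xr' yr' /linkP xy; apply: one.
  + by case: xy => -[a _]; [left|right]; exists a.
  + by rewrite inE xr' orbT.
  + by rewrite inE yr' orbT.
Qed.

(** The endomorphism [w |-> xi(w) m] is idempotent and nonzero, hence the identity. *)
Lemma string_basis_exists M v (u : M v) : indecomposable M -> u != 0 ->
  inhabited (string_basis M v).
Proof.
move=> iM u0.
have [pl [pr [m [xi /= [[lp rp] out marr xarr one]]]]] := string_family u0.
set S := walk_set v pl pr in out marr xarr one.
pose k x : 'Hom(M x, M x) := linfun (fun u => xi x u *: m x).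
have kE x w : k x w = xi x w *: m x.
  by rewrite linfun_linear // => c y z; rewrite linearP scalerDl scalerA.
have xiE x y (a : arr x y) w : y \in S -> xi y (rep_map M a w) = xi x w.
  by move=> yS; rewrite -(xarr _ _ a yS) comp_lfunE.
have m_neq0 x : (m x != 0) = (x \in S).
  have [xS|/out[-> _]] := boolP (x \in S); last by rewrite eqxx.
  apply/eqP => mx0; have /eqP := one x xS.
  by rewrite mx0 linear0 eq_sym oner_eq0.
have kh : is_hom k.
  apply: is_homP => x y a w; rewrite !kE linearZ /=.
  have [xS|/out[_ xi0]] := boolP (x \in S).
    rewrite marr //; have [yS|/out[-> _]] := boolP (y \in S).
      by rewrite xiE.
    by rewrite !scaler0.
  rewrite xi0 zero_lfunE scale0r.
  have [yS|/out[-> _]] := boolP (y \in S); last by rewrite scaler0.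
  by rewrite xiE // xi0 zero_lfunE scale0r.
have vS : v \in S by apply: walk_center.
have kid : forall x w, k x w = w.
  apply: (indecomposable_idem (e := RHom kh) iM) => /= [x w|].
    rewrite !kE linearZ /=.
    have [xS|/out[-> _]] := boolP (x \in S); last by rewrite !scaler0.
    by rewrite one // -[_ *: (1 : K^o)]/(_ * 1) mulr1.
  by exists v, (m v); rewrite kE one // scale1r m_neq0.
constructor; exists pl pr m xi => //.
- by move=> x /out[].
- by move=> x y a; rewrite m_neq0; apply: marr.
- by move=> x y a w; rewrite m_neq0 => /xiE.
- by move=> x w; rewrite -kE kid.
Qed.

Lemma string_support M v (d : string_basis M v) x :
  (x \in rep_support M) = (sm d x != 0).
Proof.
rewrite inE; congr (~~ _); rewrite dimv_eq0; apply/eqP/eqP => [M0|m0].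
  by apply/eqP; rewrite -memv0 -M0 memvf.
apply/eqP; rewrite -subv0; apply/subvP => u _.
by rewrite [u](s_basis d) m0 scaler0 mem0v.
Qed.

Lemma string_support_walk M v (d : string_basis M v) :
  rep_support M = walk_set v (sl d) (sr d).
Proof. by apply/setP => x; rewrite (string_support d) sm_mem. Qed.

Lemma pointwise_iso M N (f : rhom M N) :
    (forall x, lker (f x) = 0%VS) -> epi f ->
  exists g : rhom N M, forall x, (g x \o f x)%VF = \1%VF /\ (f x \o g x)%VF = \1%VF.
Proof.
move=> f0 fT.
have fK x : cancel (f x) (f x)^-1%VF by apply: lker0_lfunK; rewrite f0.
have fVK x : cancel (f x)^-1%VF (f x).
  by move=> u; apply: limg_lfunVK; rewrite fT memvf.
have gh : is_hom (fun x => (f x)^-1%VF).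
  by apply: is_homP => x y a u; rewrite -{1}[u]fVK -rhomE fK.
exists (RHom gh) => x; split; apply/lfunP => u;
  by rewrite comp_lfunE id_lfunE /= ?fK ?fVK.
Qed.

End Strings.

(** * Nonzero morphisms between string modules *)

Section HalfOrder.
Variables (K : fieldType) (Q : bquiver) (O : orientation Q) (rho : Q -> rat).
Hypothesis rho_out : forall v y p (b : arr v y), path (link O) y p -> O v y b ->
  rho (last y p) < rho v.
Hypothesis rho_in : forall v y p (a : arr y v), path (link O) y p -> ~~ O y v a ->
  rho v < rho (last y p).
Variables (M N : rep K Q) (f : rhom M N).
Variables (m : forall x, M x) (n : forall x, N x).
Hypothesis m_arr : forall (x y : Q) (a : arr x y), m x != 0 -> rep_map M a (m x) = m y.
Hypothesis n_arr : forall (x y : Q) (a : arr x y), n x != 0 -> rep_map N a (n x) = n y.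
Hypothesis n_basis : forall x (u : N x), exists c, u = c *: n x.
Hypothesis n_right_uniq : forall x y z,
  link O x y -> link O x z -> n y != 0 -> n z != 0 -> y = z.

(** While the two halves agree, [f] stays nonzero. Where they part, commutation with [f] forces the
    half of [M] to stop or follow an outgoing arrow, and the half of [N] to stop or follow an
    incoming one; each combination raises [rho] of the end. *)
Lemma half_order v p q :
    path (link O) v p -> path (link O) v q ->
    {in v :: p, forall x, m x != 0} -> {in v :: q, forall x, n x != 0} ->
    (forall y, link O (last v p) y -> m y = 0) ->
    (forall y, link O (last v q) y -> n y = 0) ->
    f v (m v) != 0 ->
  rho (last v p) < rho (last v q) \/
  p = q /\ {in v :: p, forall x, f x (m x) != 0}.
Proof.
elim: p v q => [|y p IH] v [|z q].
- move=> _ _ _ _ _ _ fv; right; split=> // x.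
  by rewrite inE => /eqP->.
- move=> _ /= /andP[/linkP vz qp] mS nS m0 n0 fv; left.
  case: vz => -[b ob]; last exact: rho_in ob.
  case/eqP: fv; have [c fc] := n_basis (f v (m v)).
  have : rep_map N b (f v (m v)) = 0.
    by rewrite -rhomE m_arr ?mS ?mem_head // (m0 _ (link_out ob)) linear0.
  rewrite fc linearZ /= n_arr ?nS ?mem_head // => /eqP.
  rewrite scaler_eq0 (negbTE (nS z _)) ?inE ?eqxx ?orbT // orbF => /eqP->.
  by rewrite scale0r.
- move=> /= /andP[vy pp] _ mS nS m0 n0 fv; left.
  case/linkP: (vy) => -[b ob]; first exact: rho_out ob.
  case/eqP: fv; rewrite -(m_arr b); last by rewrite mS ?inE ?eqxx ?orbT.
  have ny : n y = 0 by apply: n0; apply: link_in ob.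
  have [c fc] := n_basis (f y (m y)).
  by rewrite rhomE fc ny scaler0 linear0.
move=> /= /andP[vy pp] /andP[vz qp] mS nS m0 n0 fv.
have mv : m v != 0 by rewrite mS ?mem_head.
have my : m y != 0 by rewrite mS ?inE ?eqxx ?orbT.
have nv : n v != 0 by rewrite nS ?mem_head.
have nz : n z != 0 by rewrite nS ?inE ?eqxx ?orbT.
have next : f y (m y) != 0 -> rho (last y p) < rho (last z q) \/
    y :: p = z :: q /\ {in [:: v, y & p], forall x, f x (m x) != 0}.
  move=> fy; have [c fc] := n_basis (f y (m y)).
  have ny : n y != 0 by apply: contra fy => /eqP ny; rewrite fc ny scaler0.
  have yz := n_right_uniq vy vz ny nz.
  rewrite -yz in qp nS n0 *.
  have sub x s : x \in y :: s -> x \in [:: v, y & s] by move=> xs; rewrite inE xs orbT.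
  case: (IH y q pp qp _ _ m0 n0 fy) => [x /sub|x /sub|lt|[-> fS]];
    [exact: mS | exact: nS | by left | right; split=> // x].
  by rewrite inE => /predU1P[->//|]; apply: fS.
case/linkP: (vy) => -[b ob].
  case/linkP: (vz) => -[b' ob'].
    apply: next; rewrite -(m_arr b) // rhomE.
    have [c fc] := n_basis (f v (m v)).
    have c0 : c != 0 by apply: contra fv => /eqP c0; rewrite fc c0 scale0r.
    rewrite fc linearZ /= scaler_eq0 negb_or c0 /= n_arr //.
    have -> // : y = z.
    exact: (congr1 (@tag _ _) (side_src (etrans ob (esym ob')))).
  left; apply: lt_trans (rho_out pp ob) (rho_in qp ob').
apply: next; apply: contra fv => /eqP fy.
by rewrite -(m_arr b) // rhomE fy linear0.
Qed.

End HalfOrder.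

Section Directed.
Variables (K : fieldType) (Q : bquiver) (O : orientation Q).
Hypothesis acyclic : forall c : seq (step Q), ~~ graph_cycle c.
Implicit Types M N : rep K Q.

(** For a walk each sum has one term, at the right and at the left end; this form depends only on
    the set of vertices. *)
Definition walk_weight (rho lam : Q -> rat) (S : {set Q}) : rat :=
  \sum_(x in S | [forall y in S, ht O y <= ht O x]) rho x +
  \sum_(x in S | [forall y in S, ht O x <= ht O y]) lam x.

Lemma walk_weightE rho lam v pl pr :
    path (link (flip O)) v pl -> path (link O) v pr ->
  walk_weight rho lam (walk_set v pl pr) = rho (last v pr) + lam (last v pl).
Proof.
move=> lp rp; congr (_ + _).
  apply: big_pred1 => x /=; apply/andP/eqP => [[xS /forall_inP xT]|->].
    apply: (walk_inj lp rp) => //; first exact: walk_last_right.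
    by apply/eqP; rewrite eq_le (walk_top lp rp xS) xT ?walk_last_right.
  split; first exact: walk_last_right.
  by apply/forall_inP => y; apply: walk_top.
apply: big_pred1 => x /=; apply/andP/eqP => [[xS /forall_inP xT]|->].
  apply: (walk_inj lp rp) => //; first exact: walk_last_left.
  by apply/eqP; rewrite eq_le (walk_bot lp rp xS) xT ?walk_last_left.
split; first exact: walk_last_left.
by apply/forall_inP => y; apply: walk_bot.
Qed.

Lemma string_right_uniq M v (d : string_basis O M v) x y z :
  link O x y -> link O x z -> sm d y != 0 -> sm d z != 0 -> y = z.
Proof.
rewrite !sm_mem => /ht_link xy /ht_link xz yS zS.
by apply: (walk_inj (sl_path d) (sr_path d)) => //; rewrite xy xz.
Qed.

Lemma string_left_uniq M v (d : string_basis O M v) x y z :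
  link (flip O) x y -> link (flip O) x z -> sm d y != 0 -> sm d z != 0 -> y = z.
Proof.
rewrite !sm_mem => /ht_link /= xy /ht_link /= xz yS zS.
apply: (walk_inj (sl_path d) (sr_path d)) => //.
by apply: oppr_inj; rewrite xy xz.
Qed.

Lemma string_right_end M v (d : string_basis O M v) y :
  link O (last v (sr d)) y -> sm d y = 0.
Proof.
move=> /ht_link hy; apply/eqP/negPn; rewrite sm_mem; apply/negP.
by move=> /(walk_top (sl_path d) (sr_path d)); rewrite hy; lia.
Qed.

Lemma string_left_end M v (d : string_basis O M v) y :
  link (flip O) (last v (sl d)) y -> sm d y = 0.
Proof.
move=> /ht_link /= hy; apply/eqP/negPn; rewrite sm_mem; apply/negP.
by move=> /(walk_bot (sl_path d) (sr_path d)); lia.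
Qed.

(** Both strings are read from a vertex where [f] is nonzero. Either an end moves and the weight
    grows, or the strings coincide and [f] is nonzero between lines all along. *)
Theorem tree_directed : exists phi : {set Q} -> rat, forall M N (f : rhom M N),
  indecomposable M -> indecomposable N -> (exists x u, f x u != 0) ->
  phi (rep_support M) < phi (rep_support N) \/
  exists g : rhom N M, forall x, (g x \o f x)%VF = \1%VF /\ (f x \o g x)%VF = \1%VF.
Proof.
have [rho [rho_out rho_in]] := end_potential O acyclic.
have [lam [lam_out lam_in]] := end_potential (flip O) acyclic.
exists (walk_weight rho lam) => M N f iM iN [v [u fu]].
have u0 : u != 0 by apply: contra fu => /eqP->; rewrite linear0.
have [d] := string_basis_exists O acyclic iM u0.
have [e] := string_basis_exists O acyclic iN fu.
have fm : f v (sm d v) != 0.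
  by apply: contra fu => /eqP fm; rewrite [u](s_basis d) linearZ /= fm scaler0.
have eb x (w : N x) : exists c, w = c *: sm e x.
  by exists (sx e x w); apply: s_basis.
have dr : {in v :: sr d, forall x, sm d x != 0}.
  by move=> x xs; rewrite sm_mem inE xs orbT.
have er : {in v :: sr e, forall x, sm e x != 0}.
  by move=> x xs; rewrite sm_mem inE xs orbT.
have dl : {in v :: sl d, forall x, sm d x != 0}.
  by move=> x xs; rewrite sm_mem inE xs.
have el : {in v :: sl e, forall x, sm e x != 0}.
  by move=> x xs; rewrite sm_mem inE xs.
have R := half_order rho_out rho_in (@sm_arr _ _ _ _ _ d) (@sm_arr _ _ _ _ _ e) eb
  (string_right_uniq (d := e)) (sr_path d) (sr_path e) dr er
  (string_right_end (d := d)) (string_right_end (d := e)) fm.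
have L := half_order lam_out lam_in (@sm_arr _ _ _ _ _ d) (@sm_arr _ _ _ _ _ e) eb
  (string_left_uniq (d := e)) (sl_path d) (sl_path e) dl el
  (string_left_end (d := d)) (string_left_end (d := e)) fm.
rewrite (string_support_walk d) (string_support_walk e).
rewrite !walk_weightE; try solve [exact: sl_path | exact: sr_path].
case: R => [Rlt|[Re Rf]]; case: L => [Llt|[Le Lf]].
- by left; apply: ltrD.
- by left; rewrite Le ltrD2r.
- by left; rewrite Re ltrD2l.
right.
have fS x : sm d x != 0 -> f x (sm d x) != 0.
  by rewrite sm_mem inE => /orP[/Lf|/Rf].
have de x : (sm d x != 0) = (sm e x != 0) by rewrite !sm_mem Re Le.
apply: pointwise_iso => x.
  apply/eqP; rewrite -subv0; apply/subvP => w; rewrite memv_ker memv0.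
  rewrite [w](s_basis d) linearZ /= !scaler_eq0.
  by have [//|/fS/negbTE->] := eqVneq (sm d x) 0; rewrite ?orbT ?orbF.
apply/eqP; rewrite eqEsubv subvf /=; apply/subvP => w _.
have [ex|] := eqVneq (sm e x) 0.
  by rewrite [w](s_basis e) ex scaler0 mem0v.
rewrite -de => /fS; have [c fc] := eb x (f x (sm d x)).
rewrite fc scaler_eq0 negb_or => /andP[c0 _]; have [b ->] := eb x w.
have -> : b *: sm e x = f x ((b / c) *: sm d x).
  by rewrite linearZ /= fc scalerA divfK.
by rewrite memv_img ?memvf.
Qed.

(** Sending one string basis to the other is a nonzero morphism; as the weights are equal,
    directedness makes it invertible. *)
Theorem tree_support_iso M N : indecomposable M -> indecomposable N ->
  rep_support M = rep_support N -> rep_iso M N.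
Proof.
move=> iM iN MN.
have [v [u u0]] := nonzero_rep (proj1 iM).
have [d] := string_basis_exists O acyclic iM u0.
have : v \in rep_support N by rewrite -MN (string_support_walk d) walk_center.
rewrite inE dimv_eq0 -subv0 => /subvPnot[w _]; rewrite memv0 => w0.
have [e] := string_basis_exists O acyclic iN w0.
have de x : (sm d x != 0) = (sm e x != 0) by rewrite -!string_support MN.
pose k x : 'Hom(M x, N x) := linfun (fun u => sx d x u *: sm e x).
have kE x z : k x z = sx d x z *: sm e x.
  by rewrite linfun_linear // => c y t; rewrite linearP scalerDl scalerA.
have kh : is_hom k.
  apply: is_homP => x y a z; rewrite !kE linearZ /=.
  have [ex|ex] := eqVneq (sm e x) 0.
    rewrite ex linear0 scaler0.
    have [->|ey] := eqVneq (sm e y) 0; first by rewrite scaler0.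
    rewrite (sx_arr (s := d)) ?de // (sx_out (s := d)) ?zero_lfunE ?scale0r //.
    by rewrite -sm_mem de ex eqxx.
  rewrite sm_arr //; have [->|ey] := eqVneq (sm e y) 0; first by rewrite !scaler0.
  by rewrite sx_arr ?de.
have [phi phiP] := tree_directed.
case: (phiP _ _ (RHom kh) iM iN) => [||[g gk]]; last by exists (RHom kh), g.
  exists v, u; rewrite /= kE scaler_eq0 negb_or -de sm_mem walk_center andbT.
  apply: contra u0 => /eqP xu; by rewrite [u](s_basis d) xu scale0r.
by rewrite MN ltxx.
Qed.

End Directed.

(** * Resolving subcategories *)

Section Resolving.
Variables (K : fieldType) (Q : bquiver).
Implicit Types L M N P W X Y Z : rep K Q.

Lemma sum_neq0 (I : finType) (B : pred I) (V : zmodType) (F : I -> V) :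
  \sum_(i | B i) F i != 0 -> exists2 i, B i & F i != 0.
Proof.
move=> s0; have [i /andP[Bi Fi]|no] := pickP (fun i => B i && (F i != 0)).
  by exists i.
case/eqP: s0; apply: big1 => i Bi; apply/eqP.
by have := no i; rewrite Bi /= => /negbFE.
Qed.

Lemma kernel_lift L M N X (f : rhom L M) (g : rhom M N) (k : rhom X M) :
    short_exact f g -> (forall x u, g x (k x u) = 0) ->
  exists h : rhom X L, forall x u, f x (h x u) = k x u.
Proof.
move=> ex gk.
have fK x u : f x ((f x)^-1%VF (k x u)) = k x u.
  apply: limg_lfunVK; have [_ -> _] := ex x.
  by rewrite memv_ker gk.
have f_inj x : injective (f x) by apply/lker0P/eqP; have [] := ex x.
have hh : is_hom (fun x => (f x)^-1 \o k x)%VF.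
  apply: is_homP => x y a u; apply: f_inj.
  by rewrite rhomE !comp_lfunE !fK rhomE.
by exists (RHom hh) => x u; rewrite /= comp_lfunE fK.
Qed.

Lemma short_exact_comp L M N (f : rhom L M) (g : rhom M N) x u :
  short_exact f g -> g x (f x u) = 0.
Proof.
move=> ex; apply/eqP; rewrite -memv_ker; have [_ <- _] := ex x.
by rewrite memv_img ?memvf.
Qed.

Lemma short_exact_inj L M N (f : rhom L M) (g : rhom M N) x :
  short_exact f g -> injective (f x).
Proof. by move=> ex; apply/lker0P/eqP; have [] := ex x. Qed.

Lemma short_exact_epi L M N (f : rhom L M) (g : rhom M N) :
  short_exact f g -> epi g.
Proof. by move=> ex x; have [] := ex x. Qed.

Definition retracts_in (T : rep_class K Q) : rep_class K Q :=
  fun M => forall Z, indecomposable Z -> retract Z M -> T Z.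

Variable phi : {set Q} -> rat.
Hypothesis directed : forall M N (f : rhom M N),
  indecomposable M -> indecomposable N -> (exists x u, f x u != 0) ->
  phi (rep_support M) < phi (rep_support N) \/
  exists g : rhom N M, forall x, (g x \o f x)%VF = \1%VF /\ (f x \o g x)%VF = \1%VF.
Hypothesis support_iso : forall M N, indecomposable M -> indecomposable N ->
  rep_support M = rep_support N -> rep_iso M N.

(** By directedness the nonzero endomorphism [r s] of [Z] is invertible. *)
Lemma nonzero_retract Z M (s : rhom Z M) (r : rhom M Z) : indecomposable Z ->
  (exists x u, r x (s x u) != 0) -> retract Z M.
Proof.
move=> iZ [x [u rsu]].
case: (directed (f := rcomp r s) iZ iZ) => [|/=|[g gk]].
- by exists x, u; rewrite /= comp_lfunE.
- by rewrite ltxx.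
by exists s, (rcomp g r) => y; rewrite /= -comp_lfunA; have [] := gk y.
Qed.

Lemma sum_retract Z (I : finType) (B : pred I) (W : I -> rep K Q)
    (a : forall i, rhom Z (W i)) (b : forall i, rhom (W i) Z) :
    indecomposable Z ->
    (forall x u, \sum_(i | B i) b i x (a i x u) = u) ->
  exists2 i, B i & retract Z (W i).
Proof.
move=> iZ ab1; have [x [u u0]] := nonzero_rep (proj1 iZ).
rewrite -(ab1 x u) in u0; have [i Bi ne] := sum_neq0 u0.
by exists i => //; apply: (nonzero_retract (s := a i) (r := b i) iZ); exists x, u.
Qed.

Lemma add_retract Z V W (a : rhom Z V) (a' : rhom V Z) (b : rhom Z W)
    (b' : rhom W Z) :
    indecomposable Z -> (forall x u, a' x (a x u) + b' x (b x u) = u) ->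
  retract Z V \/ retract Z W.
Proof.
move=> iZ ab1; have [x [u u0]] := nonzero_rep (proj1 iZ).
have [av|av] := eqVneq (a' x (a x u)) 0.
  right; apply: (nonzero_retract (s := b) (r := b') iZ); exists x, u.
  by apply: contra u0 => /eqP bw; rewrite -(ab1 x u) av bw addr0.
by left; apply: (nonzero_retract (s := a) (r := a') iZ); exists x, u.
Qed.

Lemma retract_dsum Z M N : indecomposable Z -> retract Z (dsum M N) ->
  retract Z M \/ retract Z N.
Proof.
move=> iZ [s [r rs]].
apply: (add_retract (a := rcomp (dfst M N) s) (a' := rcomp r (dinl M N))
  (b := rcomp (dsnd M N) s) (b' := rcomp r (dinr M N)) iZ) => x u.
have := dsum_id M N x; move/lfunP/(_ (s x u)).
rewrite add_lfunE !comp_lfunE id_lfunE -linearD => ->.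
by rewrite /= -comp_lfunE rs id_lfunE.
Qed.

Lemma retracts_in_closed T : sum_summand_closed (retracts_in T).
Proof.
split.
- move=> M N MN DM Z iZ ZN; apply: DM => //.
  exact: retract_trans ZN (rep_iso_retract (rep_iso_sym MN)).
- by move=> M M0 Z [Z0 _] /zero_rep_retract/(_ M0).
- by move=> M N DM DN Z iZ /(retract_dsum iZ)[]; [apply: DM | apply: DN].
move=> M N DMN; split=> Z iZ ZM; apply: DMN => //; apply: retract_trans ZM _.
  exact: retract_dsuml.
exact: retract_dsumr.
Qed.

Lemma sum_summand_closed_retract (C : rep_class K Q) Z M :
  sum_summand_closed C -> retract Z M -> C M -> C Z.
Proof.
case=> isoC _ _ sumC ZM CM; have [Z' MZ] := retract_split ZM.
by have [] := sumC _ _ (isoC _ _ MZ CM).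
Qed.

Lemma sum_summand_closed_ind (C D : rep_class K Q) :
    sum_summand_closed C -> sum_summand_closed D ->
    (forall Z, indecomposable Z -> C Z -> D Z) ->
  class_sub C D.
Proof.
move=> [isoC _ _ sumC] [isoD D0 DD _] ind.
apply: rep_decomp_ind => [M N MN CD CN|M /D0|M|M N CDM CDN /sumC[CM CN]] //.
- by apply: (isoD _ _ MN); apply: CD; apply: isoC CN; apply: rep_iso_sym.
- exact: ind.
by apply: DD; auto.
Qed.

Lemma projective_closed : sum_summand_closed (@projective K Q).
Proof.
split.
- by move=> M N /rep_iso_sym/rep_iso_retract; apply: projective_retract.
- exact: projective_zero.
- exact: projective_dsum.
move=> M N pMN; split; apply: projective_retract pMN.
  exact: retract_dsuml.
exact: retract_dsumr.
Qed.

Definition below Z Y : Prop :=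
  phi (rep_support Z) < phi (rep_support Y) \/ rep_iso Z Y.

Lemma rep_iso_support M N : rep_iso M N -> rep_support M = rep_support N.
Proof. by move=> MN; apply/setP => x; rewrite !inE (rep_iso_dim x MN). Qed.

Lemma below_hom Z W Y (f : rhom Z W) : indecomposable Z -> indecomposable W ->
  (exists x u, f x u != 0) -> below W Y -> below Z Y.
Proof.
move=> iZ iW fn0; case: (directed iZ iW fn0) => [ZW|[g fg]].
  by case=> [WY|/rep_iso_support e]; left; [apply: lt_trans WY | rewrite -e].
have ZW : rep_iso Z W by exists f, g.
case=> [WY|WY]; first by left; rewrite (rep_iso_support ZW).
by right; apply: rep_iso_trans WY.
Qed.

(** * The resolving class bounded by a module *)

Section Threshold.
Variable Y : rep K Q.

Definition below_class : rep_class K Q :=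
  retracts_in (fun Z => projective Z \/ below Z Y).

(** A non-projective piece of [M] is below [Y], so a nonzero component of [k] into it would put [Z]
    below [Y]. Otherwise [k] lives on the projective pieces, collected in [B]. *)
Lemma proj_pieces M : below_class M ->
  exists (I : finType) (p : I -> piece M) (B : pred I),
  [/\ decomposition p, forall i, B i -> projective (piece_rep (p i))
    & forall Z (k : rhom Z M), indecomposable Z -> below Z Y \/
      forall x u, \sum_(i | B i) piece_in (p i) x (piece_out (p i) x (k x u)) = k x u].
Proof.
move=> DM; have [I [p [pr p1]]] := decomposition_exists M.
have [B Bp] : exists B : I -> bool, forall i, B i <-> projective (piece_rep (p i)).
  apply: (fin_all_exists (P := fun i (b : bool) =>
    b <-> projective (piece_rep (p i)))) => i.
  by have [P|P] := classic (projective (piece_rep (p i))); [exists true | exists false].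
exists I, p, B; split=> [||Z k iZ]; [by split | by move=> i /Bp |].
have [ZY|ZY] := classic (below Z Y); [by left | right=> x u].
rewrite -[RHS]p1 [RHS](bigID B) /= [X in _ = _ + X]big1 ?addr0 // => i Bi.
have [iW WM] := pr i; case: (DM _ iW WM) => [/Bp|WY]; first by rewrite (negbTE Bi).
suff -> : piece_out (p i) x (k x u) = 0 by rewrite linear0.
apply/eqP/negPn/negP => ne; apply: ZY.
apply: (below_hom (f := rcomp (piece_out (p i)) k) iZ iW) => //.
by exists x, u; rewrite /= comp_lfunE.
Qed.

Lemma lift_proj_pieces M N (g : rhom M N) (I : finType) (p : I -> piece N) (B : pred I) :
    epi g -> (forall i, B i -> projective (piece_rep (p i))) ->
  exists t : forall i, rhom (piece_rep (p i)) M,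
    forall i, B i -> forall x u, g x (t i x u) = piece_in (p i) x u.
Proof.
move=> eg pB; apply: (fin_all_exists (P := fun i (t : rhom (piece_rep (p i)) M) =>
  B i -> forall x u, g x (t x u) = piece_in (p i) x u)) => i.
(* Outside [B] the zero map serves as a default. *)
have [Bi|nB] := boolP (B i); last first.
  have z0 : is_hom (fun x => 0 : 'Hom(piece_rep (p i) x, M x)).
    by apply: is_homP => x y a u; rewrite !zero_lfunE linear0.
  by exists (RHom z0).
have [t tE] := pB i Bi _ _ g (piece_in (p i)) eg.
by exists t => _ x u; rewrite -comp_lfunE tE.
Qed.

(** If [Z] is not below [Y], then [g s] factors through projective pieces of [N] and lifts to
    [q : Z -> M], while [s - q] lands in [L]. Since [r (s - q) + r q = 1], [Z] is a retract of [L]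
    or of a projective. *)
Lemma below_class_extension L M N (f : rhom L M) (g : rhom M N) :
  short_exact f g -> below_class L -> below_class N -> below_class M.
Proof.
move=> ex DL DN Z iZ [s [r rs]].
have [I [p [B [_ pB pZ]]]] := proj_pieces DN.
case: (pZ Z (rcomp g s) iZ) => [|gs]; first by right.
have [t tE] := lift_proj_pieces (short_exact_epi ex) pB.
pose q := rsum B (fun i => rcomp (t i) (rcomp (piece_out (p i)) (rcomp g s))).
have qE x u : q x u = \sum_(i | B i) t i x (piece_out (p i) x (g x (s x u))).
  by rewrite /= sum_lfunE; apply: eq_bigr => i _; rewrite !comp_lfunE.
have gq x u : g x (q x u) = g x (s x u).
  rewrite qE linear_sum /= -[RHS]comp_lfunE -(gs x u).
  by apply: eq_bigr => i Bi; rewrite tE //= comp_lfunE.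
have [x u|h hE] := kernel_lift (k := rsub s q) ex.
  by rewrite /= add_lfunE opp_lfunE linearB /= gq subrr.
have [x [u u0]] := nonzero_rep (proj1 iZ).
have rE : r x (f x (h x u)) + r x (q x u) = u.
  rewrite hE -linearD /= add_lfunE opp_lfunE subrK.
  by rewrite -comp_lfunE rs id_lfunE.
have [fh0|fh0] := eqVneq (r x (f x (h x u))) 0; last first.
  apply: DL => //; apply: (nonzero_retract (s := h) (r := rcomp r f) iZ).
  by exists x, u; rewrite /= comp_lfunE.
rewrite -rE fh0 add0r qE linear_sum /= in u0; have [i Bi ne] := sum_neq0 u0.
left; apply: projective_retract (pB i Bi).
apply: (nonzero_retract (s := rcomp (piece_out (p i)) (rcomp g s))
  (r := rcomp r (t i)) iZ).
by exists x, u; rewrite /= !comp_lfunE.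
Qed.

(* Write f s as a sum over the projective pieces W of M; a piece through which *)
(* Z maps either has a nonzero map to a piece of N below Y, or its image in N  *)
(* lifts to M, so that its inclusion can be corrected to land in L.            *)
Lemma below_class_kernel L M N (f : rhom L M) (g : rhom M N) :
  short_exact f g -> below_class M -> below_class N -> below_class L.
Proof.
move=> ex DM DN Z iZ [s [r rs]].
have [ZY|ZY] := classic (below Z Y); [by right | left].
have [I [p [B [[pr _] pB pZ]]]] := proj_pieces DM.
have [J [q [C [_ qC qZ]]]] := proj_pieces DN.
have [//|fsE'] := pZ Z (rcomp f s) iZ.
have fsE x u : \sum_(i | B i) piece_in (p i) x (piece_out (p i) x (f x (s x u)))
    = f x (s x u) by have := fsE' x u; rewrite /= comp_lfunE.
have [t tE] := lift_proj_pieces (short_exact_epi ex) qC.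
pose k i := rcomp (piece_out (p i)) (rcomp f s).
(* [A] selects the projective pieces of [M] that [f s] really meets, [e] is the projection to them,
   and [w] lifts [g e] through the projective pieces of [N]. *)
pose A i := B i && ~~ [forall x, k i x == 0].
pose e := rsum A (fun i => rcomp (piece_in (p i)) (piece_out (p i))).
pose w := rsum C (fun j => rcomp (t j) (rcomp (piece_out (q j)) (rcomp g e))).
have kE i x u : k i x u = piece_out (p i) x (f x (s x u)).
  by rewrite /= !comp_lfunE.
have eE x u : e x u = \sum_(i | A i) piece_in (p i) x (piece_out (p i) x u).
  by rewrite /= sum_lfunE; apply: eq_bigr => i _; rewrite comp_lfunE.
have efs x u : e x (f x (s x u)) = f x (s x u).
  rewrite eE -[RHS]fsE [RHS](bigID (fun i => [forall x, k i x == 0])) /=.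
  rewrite [X in _ = X + _]big1.
    by rewrite add0r; apply: eq_bigl.
  move=> i /andP[_ /forallP k0].
  have kx0 : k i x = 0 by apply/eqP.
  by rewrite -kE kx0 zero_lfunE linear0.
(* A piece in [A] receives a nonzero map from [Z], so it is not below [Y] either, and [g] sends it
   into the projective pieces of [N]. *)
have gin i x u : A i -> \sum_(j | C j) piece_in (q j) x (piece_out (q j) x
    (g x (piece_in (p i) x u))) = g x (piece_in (p i) x u).
  move=> /andP[Bi /forallPn[y ky]]; have [iW _] := pr i.
  have [WY|] := qZ _ (rcomp g (piece_in (p i))) iW.
    case: ZY; apply: (below_hom (f := k i) iZ iW) WY.
    by move/lfunPn: ky => [v kv]; exists y, v; rewrite zero_lfunE in kv.
  by move=> /(_ x u); rewrite /= comp_lfunE.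
have gw x u : g x (w x u) = g x (e x u).
  transitivity (\sum_(j | C j) piece_in (q j) x (piece_out (q j) x (g x (e x u)))).
    rewrite [w x u]sum_lfunE linear_sum; apply: eq_bigr => j Cj.
    by rewrite comp_lfunE [LHS]tE // comp_lfunE comp_lfunE.
  rewrite eE !linear_sum.
  under eq_bigr => j _ do rewrite !linear_sum.
  rewrite exchange_big; apply: eq_bigr => i Ai; exact: gin.
have wfs x u : w x (f x (s x u)) = 0.
  rewrite [w x _]sum_lfunE big1 // => j _.
  by rewrite !comp_lfunE efs (short_exact_comp _ ex) !linear0.
(* Now [e - w] lands in [L], and it fixes [f s] because [w] vanishes there; so [s = h f s] factors
   through projective pieces of [M]. *)
have [x u|h hE] := kernel_lift (k := rsub e w) ex.
  by rewrite /= add_lfunE opp_lfunE linearB /= gw subrr.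
have hfs x u : h x (f x (s x u)) = s x u.
  apply: (short_exact_inj ex); rewrite hE /= add_lfunE opp_lfunE.
  by rewrite [e x _]efs wfs subr0.
have [|i Bi ZW] := @sum_retract Z I B (fun i => piece_rep (p i)) k
  (fun i => rcomp r (rcomp h (piece_in (p i)))) iZ.
  move=> x u; transitivity (r x (h x (f x (s x u)))); last first.
    by rewrite hfs -comp_lfunE rs id_lfunE.
  rewrite -[in RHS]fsE !linear_sum; apply: eq_bigr => i _.
  by rewrite kE /= !comp_lfunE.
exact: projective_retract ZW (pB i Bi).
Qed.

Lemma below_class_resolving : resolving below_class.
Proof.
split.
- exact: retracts_in_closed.
- by move=> P pP Z _ ZP; left; apply: projective_retract pP.
- exact: below_class_extension.
exact: below_class_kernel.
Qed.

Lemma below_class_self : indecomposable Y -> below_class Y.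
Proof.
move=> iY Z iZ [s [r rs]]; right.
apply: (below_hom (f := s) iZ iY); last by right; apply: rep_iso_refl.
have [x [u u0]] := nonzero_rep (proj1 iZ); exists x, u.
apply: contra u0 => /eqP su; move/lfunP/(_ u): (rs x).
by rewrite comp_lfunE su linear0 id_lfunE => <-.
Qed.

End Threshold.

Lemma Res1_below X Y : nonproj_indec X -> indecomposable Y -> Res1 Y X -> below X Y.
Proof.
move=> [iX pX] iY /(_ _ (below_class_resolving Y)) DX.
have : below_class Y X by apply: DX => _ ->; apply: below_class_self.
by move=> /(_ X iX (retract_refl X))[].
Qed.

(** * The Res-order and generating antichains *)

Lemma Res1_self M : Res1 M M.
Proof. by move=> D _; apply. Qed.

Lemma res_leP M N : Res1 N M <-> res_le M N.
Proof.
split=> [NM L ML D rD ND|]; last by apply; apply: Res1_self.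
by apply: ML => // _ ->; apply: NM.
Qed.

Lemma res_le_trans L M N : res_le L M -> res_le M N -> res_le L N.
Proof. by move=> LM MN X /LM /MN. Qed.

Lemma resolving_Res1 M : resolving (Res1 M).
Proof.
split; first split.
- by move=> X Y XY MX D rD DM; have [[iso _ _ _] _ _ _] := rD;
    apply: iso XY (MX D rD DM).
- by move=> X X0 D rD DM; have [[_ z _ _] _ _ _] := rD; apply: z.
- move=> X Y MX MY D rD DM; have [[_ _ sum _] _ _ _] := rD.
  by apply: sum; [apply: MX | apply: MY].
- by move=> X Y MXY; split=> D rD DM; have [[_ _ _ sum] _ _ _] := rD;
    have [] := sum _ _ (MXY D rD DM).
- by move=> P pP D rD DM; have [_ p _ _] := rD; apply: p.
- move=> X Y Z f g ex MX MZ D rD DM; have [_ _ e _] := rD.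
  by apply: e ex _ _; [apply: MX | apply: MZ].
move=> X Y Z f g ex MX MZ D rD DM; have [_ _ _ e] := rD.
by apply: e ex _ _; [apply: MX | apply: MZ].
Qed.

Lemma res_le_iso M N : rep_iso M N -> res_le M N.
Proof.
move=> MN; apply/res_leP; have [[iso _ _ _] _ _ _] := resolving_Res1 N.
exact (iso _ _ (rep_iso_sym MN) (@Res1_self N)).
Qed.

Lemma res_le_antisym M N : nonproj_indec M -> nonproj_indec N ->
  res_le M N -> res_le N M -> rep_iso M N.
Proof.
move=> nM nN /res_leP NM /res_leP MN.
case: (Res1_below nM (proj1 nN) NM) => // lt1.
case: (Res1_below nN (proj1 nM) MN) => [lt2|]; last exact: rep_iso_sym.
by have := lt_trans lt1 lt2; rewrite ltxx.
Qed.

Lemma nonproj_indec_iso M N : rep_iso M N -> nonproj_indec M -> nonproj_indec N.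
Proof.
move=> MN [[M0 iM] pM]; split; first split.
- by move=> N0; apply: M0; apply: zero_rep_retract N0; apply: rep_iso_retract.
- by move=> X Y NXY; apply: iM; apply: rep_iso_trans NXY.
by move=> pN; apply: pM; apply: projective_retract pN; apply: rep_iso_retract.
Qed.

Definition maximal_in (C : rep_class K Q) : rep_class K Q := fun M =>
  [/\ C M, nonproj_indec M &
      forall N, C N -> nonproj_indec N -> res_le M N -> res_le N M].

(** Induction on a set of supports containing those of all elements above [M]. *)
Lemma maximal_above (C : rep_class K Q) M : C M -> nonproj_indec M ->
  exists2 N, maximal_in C N & res_le M N.
Proof.
pose up M (A : {set Q}) := exists N,
  [/\ rep_support N = A, C N, nonproj_indec N & res_le M N].
suff main (F : {set {set Q}}) : forall M, (forall A, up M A -> A \in F) ->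
    C M -> nonproj_indec M -> exists2 N, maximal_in C N & res_le M N.
  by apply: (main setT) => A _; rewrite inE.
have [n] := ubnP #|F|; elim: n F => // n IH F Fn {}M upF CM nM.
have [max|nmax] := classic (maximal_in C M).
  by exists M => //.
have [N [CN nN MN NM]] : exists N, [/\ C N, nonproj_indec N, res_le M N & ~ res_le N M].
  apply: NNPP => no; apply: nmax; split=> // N CN nN MN.
  by apply: NNPP => NM; apply: no; exists N.
have MF : rep_support M \in F by apply: upF; exists M; split.
have Fn' : (#|F :\ rep_support M| < n)%N.
  by move: Fn; rewrite (cardsD1 (rep_support M)) MF.
(* An element above [N] with the support of [M] would be isomorphic to [M], giving [N] under [M]. *)
have upN A : up N A -> A \in F :\ rep_support M.
  move=> [X [XA CX nX NX]]; rewrite !inE; apply/andP; split; last first.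
    by apply: upF; exists X; split=> //; apply: res_le_trans NX.
  apply/eqP => AM; apply: NM; apply: res_le_trans NX (res_le_iso _).
  by apply: support_iso; [case: nX | case: nM | rewrite XA].
have [X maxX NX] := IH _ Fn' N upN CN nN.
by exists X => //; apply: res_le_trans NX.
Qed.

Lemma resolving_antichain (C : rep_class K Q) : resolving C ->
  exists E : rep_class K Q,
    (antichain E /\ class_eq C (add_Res E)) /\
    (forall E' : rep_class K Q,
       antichain E' /\ class_eq C (add_Res E') -> class_eq E' E).
Proof.
move=> rC; have [cC pC _ _] := rC; have [isoC _ _ _] := cC.
have C_Res M L : C M -> Res1 M L -> C L by move=> CM; apply=> // _ ->.
exists (maximal_in C); split; first split.
- split=> [M N MN [CM nM mM]|M [] //|M N [CM nM mM] [CN nN _] MN].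
    split; [exact: isoC CM | exact: nonproj_indec_iso nM |].
    move=> X CX nX NX; apply: res_le_trans (res_le_iso MN).
    by apply: mM => //; apply: res_le_trans NX; apply: res_le_iso.
  by apply: res_le_antisym => //; apply: mM.
- move=> M; split=> [CM|[proj addM]].
    split=> [noE|[M0 E0] D cD sub].
      apply: (sum_summand_closed_ind cC projective_closed) CM => Z iZ CZ.
      apply: NNPP => pZ; have [N /noE //] := maximal_above CZ (conj iZ pZ).
    apply: (sum_summand_closed_ind cC cD) CM => Z iZ CZ; apply: sub.
    (* A projective lies in Res of any element, so one maximal [M0] is enough. *)
    have [pZ|pZ] := classic (projective Z).
      by exists M0; split=> // D' [_ pD' _ _] _; apply: pD'.
    have [N mN ZN] := maximal_above CZ (conj iZ pZ).
    by exists N; split=> //; apply/res_leP.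
  have [[M0 E0]|noE] := classic (exists M0, maximal_in C M0).
    apply: addM => //; first by exists M0.
    by move=> L [N [[CN _ _] NL]]; apply: C_Res NL.
  by apply: pC; apply: proj => X EX; apply: noE; exists X.
move=> E' [[isoE' nE' acE'] CE'].
have E'C M : E' M -> C M.
  move=> E'M; apply/CE'; split=> [/(_ M)//|_ D _]; apply.
  by exists M; split=> //; apply: Res1_self.
(* The modules whose non-projective indecomposable retracts lie under members of [E'] are closed
   under sums and summands and contain every generator. *)
have cover X : C X -> nonproj_indec X -> exists2 M, E' M & res_le X M.
  move=> /CE'[projX addX] nX.
  have [E'n0|E'0] := classic (exists M, E' M); last first.
    by case: nX => _ []; apply: projX => M E'M; apply: E'0; exists M.
  have := addX E'n0 _ (retracts_in_closed
    (fun Z => nonproj_indec Z -> exists2 M, E' M & res_le Z M)).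
  apply=> //; [|by case: nX|exact: retract_refl].
  move=> L [M [E'M ML]] Z iZ ZL _; exists M => //; apply/res_leP.
  have [cM _ _ _] := resolving_Res1 M.
  exact: sum_summand_closed_retract ZL ML.
move=> M; split=> [E'M|[CM nM mM]].
  split=> [||N CN nN MN]; [exact: E'C | exact: nE' |].
  have [X E'X NX] := cover N CN nN.
  have MX : rep_iso M X by apply: acE' => //; apply: res_le_trans NX.
  by apply: res_le_trans NX (res_le_iso (rep_iso_sym MX)).
have [X E'X MX] := cover M CM nM.
have nX := nE' X E'X; have XM := mM X (E'C X E'X) nX MX.
exact: (isoE' X M (res_le_antisym nX nM XM MX) E'X).
Qed.

End Resolving.

Theorem proposition3p16 (K : closedFieldType) (Q : bquiver)
    (hQ : gentle_tree Q) (C : rep_class K Q) (hC : resolving C) :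
  exists E : rep_class K Q,
    (antichain E /\ class_eq C (add_Res E)) /\
    (forall E' : rep_class K Q,
       antichain E' /\ class_eq C (add_Res E') -> class_eq E' E).
Proof.
have [gQ [_ _ acyclic]] := hQ.
have [O] := orientation_exists gQ acyclic.
have [phi directed] := tree_directed K O acyclic.
have sup := tree_support_iso O acyclic.
exact: (resolving_antichain directed (@sup K) hC).
Qed.
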